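(* Let $p>1$, let $X$ be a Banach space and let $\|\cdot\|$ be an equivalent norm on $X$ which is locally uniformly convex and uniformly smooth. For any proper lower semi-continuous bounded below function $f:X\to\mathbb{R}\cup\{+\infty\}$, consider the sequence of $\Delta$-convex functions given by $$\Delta_n^p f := \mathrm{co}\, g_n^p - 2^{p-1}n\|\cdot\|^p \qquad (n\in\mathbb{N}),$$ where $g_n^p$ at a point $x\in X$ is defined as $$g_n^p(x):=\inf_{y\in X}\Big\{ f(y)+2^{p-1}n\|x\|^p+2^{p-1}n\|y\|^p-n\|x+y\|^p\Big\}+2^{p-1}n\|x\|^p .$$ Then the following assertions are satisfied. (i) For all $n$, $\inf f\le \Delta_n^p f\le f$ and $\mathfrak{S}_{\mathfrak{Inf}}(\Delta_n^p f)=\mathfrak{S}_{\mathfrak{Inf}}(f)$. (ii) $(\Delta_n^p f)_{n\in\mathbb{N}}\subset \mathcal{C}_{\mathcal{B}}^{1,u}(X)$; and $(\Delta_n^p f)_{n\in\mathbb{N}}\subset \mathcal{C}_{\mathcal{B}}^{1,\alpha}(X)$ provided that the modulus of smoothness of the norm $\|\cdot\|$ is of power type $1+\alpha$ ($0<\alpha\le 1$); actually, in this last case, $(\Delta_n^{1+\alpha} f)_{n\in\mathbb{N}}\subset \mathcal{C}^{1,\alpha}(X)$. (iii) $\Delta_n^p f\to f$ pointwise as $n\to\infty$, and $\Delta_n^p f\to f$ uniformly on compact sets if $f:X\to\mathbb{R}$ is continuous. If moreover the norm $\|\cdot\|$ is uniformly convex, then: (iv) $\Delta_n^p f\to f$ uniformly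 on bounded sets whenever $f$ is uniformly continuous on bounded sets. (v) $\Delta_n^p f\to f$ uniformly on $X$ provided that $f$ is uniformly continuous on $X$ (here $f$ is not necessarily bounded below) and the modulus of convexity of the norm $\|\cdot\|$ is of power type $p$ ($p\ge 2$).
   Context: A function $f:X\to\mathbb{R}\cup\{+\infty\}$ is proper if $f\not\equiv+\infty$. $\mathfrak{S}_{\mathfrak{Inf}}(f)$ denotes the (possibly empty) set $\{x\in X: f(x)=\inf f\}$. A function on $X$ is $\Delta$-convex if it can be expressed as the difference of two continuous convex functions. The convex envelope $\mathrm{co}\, f$ of a function $f:X\to\mathbb{R}\cup\{+\infty\}$ is the greatest proper convex lower semi-continuous function below $f$ (if there exists a convex minorant of $f$); its value at $x\in X$ is given by $$(\mathrm{co}\, f)(x)=\inf_{n\in\mathbb{N}}\Big\{\sum_{i=1}^n\lambda_i f(x_i): x=\sum_{i=1}^n\lambda_i x_i,\ \sum_{i=1}^n\lambda_i=1,\ (x_i,\lambda_i)_{i=1}^n\subset X\times\mathbb{R}_+\Big\}.$$ Differentiability is in the Fréchet sense. $\mathcal{C}_{\mathcal{B}}^{1,u}(X)$ is the set of differentiable functions on $X$ whose derivative is uniformly continuous on bounded sets. For $0<\alpha\le1$, $\mathcal{C}^{1,\alpha}(X)$ (resp. $\mathcal{C}_{\mathcal{B}}^{1,\alpha}(X)$) is the set of differentiable functions on $X$ whose derivative is $\alpha$-Hölder continuous (resp. $\alpha$-Hölder continuous on bounded sets). The moduli of smoothness and convexity of a norm, and their being of power type $q$, have their usual meaning ($\rho(t)\le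 Ct^{q}$, resp. $\delta(\varepsilon)\ge C\varepsilon^{q}$, for some $C>0$).
   Formalization: In (ii), the claim of membership in C_B^{1,α} for general p is proved with exponent min(α, p−1) instead of α; for p < 1+α the printed claim fails (f = 0 at 0, +∞ elsewhere gives Δ_n^p f = (2^{p−1}−1)n‖x‖^p). For p ≥ 1+α it is unchanged. *)

(* Defs.v *)
(* MathComp-Analysis *)
From HB Require Import structures.
From mathcomp Require Import all_boot all_order all_algebra.
From mathcomp Require Import all_classical all_reals all_analysis.

Set Implicit Arguments.
Unset Strict Implicit.
Unset Printing Implicit Defensive.

Import Order.TTheory GRing.Theory Num.Theory.
Import numFieldNormedType.Exports.

Local Open Scope classical_set_scope.
Local Open Scope ring_scope.

Section norms.
Context {R : realType} {X : normedModType R}.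
Implicit Types N : X -> R.

Definition equivalent_norm N : Prop :=
  [/\ forall x y, N (x + y) <= N x + N y,
      forall (a : R) x, N (a *: x) = `|a| * N x &
      exists c C : R, [/\ 0 < c, 0 < C &
        forall x, c * `|x| <= N x /\ N x <= C * `|x|]].

Definition locally_uniformly_convex N : Prop :=
  forall (x : X) (u : nat -> X),
    N x = 1 -> (forall k, N (u k) = 1) ->
    N (x + u k) @[k --> \oo] --> (2 : R) ->
    N (x - u k) @[k --> \oo] --> (0 : R).

(* The set is empty only if X = 0, in which case the modulus is 0; otherwise
   it is bounded above by t, so that sup is the actual supremum. *)
Definition smoothness_modulus N (t : R) : R :=
  sup [set r | exists x y : X, [/\ N x = 1, N y = 1 &
    r = (N (x + t *: y) + N (x - t *: y)) / 2 - 1]].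

Definition uniformly_smooth N : Prop :=
  smoothness_modulus N t / t @[t --> 0^'+] --> (0 : R).

Definition smoothness_power_type N (q : R) : Prop :=
  exists2 C : R, 0 < C &
    forall t, 0 < t -> smoothness_modulus N t <= C * t `^ q.

(* Extended-real valued, so that the modulus of the trivial space is +oo. *)
Definition convexity_modulus N (e : R) : \bar R :=
  ereal_inf [set r | exists x y : X, [/\ N x = 1, N y = 1, e <= N (x - y) &
    r = (1 - N (x + y) / 2)%:E]].

Definition uniformly_convex N : Prop :=
  forall e : R, 0 < e <= 2 -> (0 < convexity_modulus N e)%E.

Definition convexity_power_type N (q : R) : Prop :=
  exists2 C : R, 0 < C &
    forall e, 0 < e <= 2 -> ((C * e `^ q)%:E <= convexity_modulus N e)%E.

End norms.

Section extended_real_functions.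
Context {R : realType} {X : normedModType R}.
Local Open Scope ereal_scope.
Implicit Types f F : X -> \bar R.

(* Functions into R u {+oo} that are not identically +oo. *)
Definition proper_fun f : Prop :=
  (forall x, -oo < f x) /\ exists x, f x < +oo.

Definition bounded_below f : Prop := exists m : R, forall x, m%:E <= f x.

Definition inf_fun f : \bar R := ereal_inf (range f).

Definition minimizers f : set X := [set x | f x = inf_fun f].

(* Used for f > -oo only; 0 * +oo = 0 makes the cases t = 0, 1 trivial. *)
Definition econvex f : Prop :=
  forall (x y : X) (t : R), (0 <= t <= 1)%R ->
    f (t *: x + (1 - t) *: y)%R <= t%:E * f x + (1 - t)%:E * f y.

(* The greatest proper convex lower semicontinuous minorant: a pointwise
   supremum of such minorants of a proper F is again one, as soon as there is
   at least one. *)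
Definition convex_envelope F (x : X) : \bar R :=
  ereal_sup [set h x | h in [set h : X -> \bar R |
    [/\ proper_fun h, econvex h, lower_semicontinuous h &
        forall y, h y <= F y]]].

Definition Delta_convex F : Prop :=
  exists c1 c2 : X -> R,
    [/\ convex_function setT c1 /\ continuous c1,
        convex_function setT c2 /\ continuous c2 &
        forall x, F x = (c1 x - c2 x)%:E].

(* Uniform convergence in the metric of R: the uniform structure of \bar R,
   which is that of a compact space, would give a weaker notion. *)
Definition cvg_uniformly_on (A : set X) (F : nat -> X -> \bar R)
    (f : X -> R) : Prop :=
  forall e : R, (0 < e)%R ->
    \forall n \near \oo, forall x, A x -> `|F n x - (f x)%:E| <= e%:E.

End extended_real_functions.

Section smoothness_classes.
Context {R : realType} {X : normedModType R}.
Implicit Types h : X -> R.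

Definition dual_norm (phi : X -> R) : R :=
  sup [set `|phi v| | v in [set v : X | `|v| <= 1]].

Definition derivative_dist h (x y : X) : R :=
  dual_norm (fun v => 'd h x v - 'd h y v).

Definition unif_continuous_on_bounded h : Prop :=
  forall A : set X, bounded_set A ->
    forall e : R, 0 < e -> exists2 d : R, 0 < d &
      forall x y, A x -> A y -> `|x - y| < d -> `|h x - h y| < e.

Definition C1u_bounded_real h : Prop :=
  (forall x, differentiable h x) /\
  forall A : set X, bounded_set A ->
    forall e : R, 0 < e -> exists2 d : R, 0 < d &
      forall x y, A x -> A y -> `|x - y| < d -> derivative_dist h x y < e.

Definition derivative_hoelder_on (A : set X) (a : R) h : Prop :=
  exists C : R, forall x y, A x -> A y ->
    derivative_dist h x y <= C * `|x - y| `^ a.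

(* An extended-real valued function belongs to one of the following classes
   if it is finite everywhere and belongs to the class as a real function. *)
Definition C1u_bounded (F : X -> \bar R) : Prop :=
  exists2 h, F = EFin \o h & C1u_bounded_real h.

Definition C1hoelder_bounded (a : R) (F : X -> \bar R) : Prop :=
  exists2 h, F = EFin \o h & (forall x, differentiable h x) /\
    forall A : set X, bounded_set A -> derivative_hoelder_on A a h.

Definition C1hoelder (a : R) (F : X -> \bar R) : Prop :=
  exists2 h, F = EFin \o h & (forall x, differentiable h x) /\
    derivative_hoelder_on setT a h.

End smoothness_classes.

Section regularization.
Context {R : realType} {X : normedModType R}.
Local Open Scope ereal_scope.

Definition g_reg (N : X -> R) (p : R) (n : nat) (f : X -> \bar R) (x : X) :
    \bar R :=
  ereal_inf [set f y +
      (2 `^ (p - 1) * n%:R * N x `^ p + 2 `^ (p - 1) * n%:R * N y `^ p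
       - n%:R * N (x + y)%R `^ p)%:E | y in setT]
  + (2 `^ (p - 1) * n%:R * N x `^ p)%:E.

Definition Delta_reg (N : X -> R) (p : R) (n : nat) (f : X -> \bar R) (x : X) :
    \bar R :=
  convex_envelope (g_reg N p n f) x - (2 `^ (p - 1) * n%:R * N x `^ p)%:E.

End regularization.

(* Main.v *)
(* Write k x = 2 `^ (p - 1) * N x `^ p and c x y = k x + k y - N (x + y) `^ p,
   which is nonnegative, so that the regularization is
   g_n x = inf_y (f y + n * c x y) + n * k x, and let phi = co g_n.

   Lower bounds. Differentiability of k at x gives
   k z >= k x + 'd k x (z - x) + c x z, hence, as soon as
   M <= f y + n * (c x z + c z y) for all z and y, the affine function
   z |-> M + n * (k x + 'd k x (z - x)) is a minorant of g_n, and
   M <= Delta_n f x. Convexity of the norm bounds c x z + c z y away from 0 for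
   y outside a ball around x (locally uniformly in x, uniformly on bounded sets,
   or by a multiple of N (x - y) `^ p according to the assumption on N), which
   gives the statements on minimizers and on convergence.

   Smoothness. Since second differences of the convex function N `^ p are
   nonnegative, those of the functions whose infimum defines g_n are at most
   2 * n times those of k. The averages (phi (x + v) + phi (x - v)) / 2 are
   convex and continuous in x, so the maximality of phi transfers such bounds
   to phi, even when they grow with N x `^ p, as g_n dominates a multiple of
   N `^ p. A convex function with small second differences is differentiable,
   with a modulus of continuity of its derivative read off from them. *)
Require Import Defs.
From HB Require Import structures.
From mathcomp Require Import all_boot all_order all_algebra.
From mathcomp Require Import all_classical all_reals all_analysis.
From mathcomp Require Import ring lra.
Set Implicit Arguments.
Unset Strict Implicit.
Unset Printing Implicit Defensive.
Import Order.TTheory GRing.Theory Num.Theory.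
Import numFieldNormedType.Exports.
Local Open Scope classical_set_scope.
Local Open Scope ring_scope.

(** * Inequalities for real powers *)

Section power.
Context {R : realType}.
Implicit Types p a b s t u x : R.

Lemma powRD_gt0 (x r s : R) : 0 < x -> x `^ (r + s) = x `^ r * x `^ s.
Proof. by move=> x0; apply: powRD; apply/implyP => _; rewrite gt_eqF. Qed.

Lemma powR_conv p t a b : 1 <= p -> 0 <= t <= 1 -> 0 <= a -> 0 <= b ->
  (t * a + (1 - t) * b) `^ p <= t * a `^ p + (1 - t) * b `^ p.
Proof.
move=> p1 /andP[t0 t1] a0 b0.
have t01 : 0 <= t <= 1 by rewrite t0.
have := convex_powR p1 (Itv01 t0 t1).
move=> /(_ a b); rewrite !inE /= !in_itv /= !andbT => /(_ a0 b0).
by rewrite !convRE.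
Qed.

(** Young's inequality for [x * 1] with the conjugate exponents [p] and [p / (p - 1)], multiplied by
    [p]. *)
Lemma powR_bernoulli p x : 1 < p -> 0 <= x -> 1 + p * (x - 1) <= x `^ p.
Proof.
move=> p1 x0; have p0 : 0 < p by lra.
have q0 : 0 < p / (p - 1) by apply: divr_gt0 => //; lra.
have := @conjugate_powR R x 1 p (p / (p - 1)) x0 ler01 p0 q0.
have -> : p^-1 + (p / (p - 1))^-1 = 1 by field; rewrite gt_eqF//=; lra.
move=> /(_ erefl); rewrite mulr1 powR1 div1r.
have -> : x `^ p / p + (p / (p - 1))^-1 = (x `^ p + p - 1) / p.
  by field; rewrite gt_eqF//= subr_eq0 gt_eqF.
rewrite ler_pdivlMr//; lra.
Qed.

(** Bernoulli at [1 + u] and [1 - u] would only give a nonnegative value. Applied to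
    [w = sqrt (1 + u)] and then squared, it leaves the excess [p * (p - 1) * (w - 1) ^+ 2] over
    [1 + p * u], which makes the inequality strict. *)
Lemma powR_symm_gap p u : 1 < p -> 0 < u <= 1 ->
  0 < (1 + u) `^ p + (1 - u) `^ p - 2.
Proof.
move=> p1 /andP[u0 u1].
have h1 := @powR_bernoulli p (1 - u) p1 ltac:(lra).
set w := Num.sqrt (1 + u).
have w2 : w ^+ 2 = 1 + u by rewrite sqr_sqrtr; lra.
have w1 : 1 < w.
  by rewrite -[X in X < _]sqrtr1 ltr_sqrt; lra.
have h2 := @powR_bernoulli p w p1 ltac:(lra).
have -> : (1 + u) `^ p = (w `^ p) ^+ 2.
  by rewrite -w2 !expr2 powRM //; lra.
have : (1 + p * (w - 1)) ^+ 2 <= (w `^ p) ^+ 2.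
  by rewrite lerXn2r ?nnegrE ?powR_ge0//; nra.
have : 0 < p * (p - 1) * (w - 1) ^+ 2.
  by rewrite !mulr_gt0 ?exprn_gt0//; lra.
nra.
Qed.

(** With [l = u / u'], the points [1 + u] and [1 - u] are convex combinations of [1 + u'], [1 - u']
    and [1], so the left side is at most [l] times the right side. *)
Lemma powR_symm_homo p u u' : 1 < p -> 0 < u -> u <= u' -> u' <= 1 ->
  (1 + u) `^ p + (1 - u) `^ p - 2 <= (1 + u') `^ p + (1 - u') `^ p - 2.
Proof.
move=> p1 u0 uu' u'1; have u'0 : 0 < u' by lra.
have l01 : 0 <= u / u' <= 1.
  by rewrite divr_ge0 ?ler_pdivrMr//; lra.
have lE : u / u' * u' = u by rewrite divfK// gt_eqF.
have h1 := @powR_conv p (u / u') (1 + u') 1 (ltW p1) l01 ltac:(lra) ler01.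
have h2 := @powR_conv p (u / u') (1 - u') 1 (ltW p1) l01 ltac:(lra) ler01.
have D0 : 0 < (1 + u') `^ p + (1 - u') `^ p - 2 by apply: powR_symm_gap; lra.
move: h1 h2; rewrite !powR1 !mulr1.
rewrite (_ : u / u' * (1 + u') + (1 - u / u') = 1 + u); last by nra.
rewrite (_ : u / u' * (1 - u') + (1 - u / u') = 1 - u); last by nra.
case/andP: l01; move: (u / u') => l *; nra.
Qed.

Lemma powR_gap p M e : 1 < p -> 0 < M -> 0 < e ->
  exists2 d, 0 < d & forall a b, 0 <= a <= M -> 0 <= b -> e <= `|a - b| ->
    d <= 2 `^ (p - 1) * (a `^ p + b `^ p) - (a + b) `^ p.
Proof.
move=> p1 M0 e0; set u0 := (e / 2) / (e / 2 + M).
have u00 : 0 < u0 by rewrite divr_gt0//; lra.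
have u01 : u0 <= 1 by rewrite ler_pdivrMr; lra.
exists (2 `^ (p - 1) * ((e / 2) `^ p * ((1 + u0) `^ p + (1 - u0) `^ p - 2))).
  by rewrite !mulr_gt0 ?powR_gt0 ?powR_symm_gap ?u00//; lra.
move=> a b /andP[a0 aM] b0.
set s := (a + b) / 2; set t := `|a - b| / 2 => et.
have -> : 2 `^ (p - 1) * (a `^ p + b `^ p) - (a + b) `^ p =
    2 `^ (p - 1) * ((s + t) `^ p + (s - t) `^ p - 2 * s `^ p).
  have -> : (a + b) `^ p = 2 `^ (p - 1) * (2 * s `^ p).
    rewrite mulrA (mulrC _ 2) mulr_powRB1 -?powRM//; rewrite /s; try lra.
    by rewrite mulrC divfK.
  rewrite -mulrBr; congr (_ * (_ - _)).
  have [ab|ab] := leP a b.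
    have -> : s + t = b by rewrite /s /t ler0_norm; lra.
    have -> : s - t = a by rewrite /s /t ler0_norm; lra.
    by rewrite addrC.
  have -> : s + t = a by rewrite /s /t gtr0_norm; lra.
  have -> // : s - t = b by rewrite /s /t gtr0_norm; lra.
have te : e / 2 <= t by rewrite /t; lra.
have ts : t <= s by rewrite /t /s; case: (ger0P (a - b)) => ab; lra.
have tM : s - M <= t by rewrite /t /s; case: (ger0P (a - b)) => ab; lra.
have s0 : 0 < s by lra.
have uts : u0 <= t / s.
  rewrite ler_pdivlMr// /u0 mulrAC ler_pdivrMr; last lra.
  nra.
have ts1 : t / s <= 1 by rewrite ler_pdivrMr// mul1r.
have -> : s + t = s * (1 + t / s).
  by rewrite mulrDr mulr1 [s * _]mulrC divfK// gt_eqF.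
have -> : s - t = s * (1 - t / s).
  by rewrite mulrBr mulr1 [s * _]mulrC divfK// gt_eqF.
have ts0 : 0 < t / s by lra.
rewrite (@powRM _ s (1 + t / s)) ?(@powRM _ s (1 - t / s)); try lra.
rewrite ler_pM2l ?powR_gt0//.
rewrite (_ : s `^ p * (1 + t / s) `^ p + s `^ p * (1 - t / s) `^ p - 2 * s `^ p
  = s `^ p * ((1 + t / s) `^ p + (1 - t / s) `^ p - 2)); last by ring.
apply: ler_pM; rewrite ?powR_ge0//.
- by apply/ltW/powR_symm_gap => //; rewrite u00.
- by apply: ge0_ler_powR; rewrite ?nnegrE; lra.
- exact: powR_symm_homo.
Qed.

Lemma powR_mid p a b : 1 <= p -> 0 <= a -> 0 <= b ->
  (a + b) `^ p <= 2 `^ (p - 1) * (a `^ p + b `^ p).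
Proof.
move=> p1 a0 b0.
have h := @powR_conv p 2^-1 a b p1 ltac:(lra) a0 b0.
have -> : (a + b) `^ p = 2 `^ p * (2^-1 * a + (1 - 2^-1) * b) `^ p.
  by rewrite -powRM//; [congr (_ `^ _); lra|lra].
rewrite -(@mulr_powRB1 _ 2 p)//; last lra.
have : 0 <= 2 `^ (p - 1) :> R := powR_ge0 _ _.
move: h; set X := (_ `^ p); nra.
Qed.

Lemma powR_superadd p a b : 1 <= p -> 0 <= a -> 0 <= b ->
  a `^ p + b `^ p <= (a + b) `^ p.
Proof.
move=> p1 a0 b0; rewrite -!(@mulr_powRB1 _ _ p)//; try lra.
have h c : 0 <= c -> c <= a + b -> c `^ (p - 1) <= (a + b) `^ (p - 1).
  by move=> c0 c1; apply: ge0_ler_powR; rewrite ?nnegrE; lra.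
have := h a a0 ltac:(lra); have := h b b0 ltac:(lra).
move: (_ `^ _) (_ `^ _) (_ `^ _) => A B C *; nra.
Qed.

Lemma powR_lipschitz_below p s t : 1 <= p -> 0 <= t -> t <= s ->
  (s - t) * s `^ (p - 1) <= s `^ p - t `^ p.
Proof.
move=> p1 t0 ts; rewrite -!(@mulr_powRB1 _ _ p)//; try lra.
have : t `^ (p - 1) <= s `^ (p - 1) by apply: ge0_ler_powR; rewrite ?nnegrE; lra.
move: (_ `^ _) (_ `^ _) => A B *; nra.
Qed.

(** Superadditivity of the power [p / 2] applied to [(a + b) ^+ 2] and [(a - b) ^+ 2], then the
    parallelogram identity, then midpoint convexity of the same power. *)
Lemma powR_clarkson p a b : 2 <= p -> 0 <= a -> 0 <= b ->
  `|a - b| `^ p <= 2 `^ (p - 1) * (a `^ p + b `^ p) - (a + b) `^ p.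
Proof.
move=> p2 a0 b0.
have h x : 0 <= x -> x `^ p = (x ^+ 2) `^ (p / 2).
  by move=> x0; rewrite -powR_mulrn// -powRrM; congr (_ `^ _); lra.
have h1 := @powR_mid (p / 2) (a ^+ 2) (b ^+ 2) ltac:(lra) (sqr_ge0 _) (sqr_ge0 _).
have h2 := @powR_superadd (p / 2) ((a + b) ^+ 2) ((a - b) ^+ 2) ltac:(lra)
  (sqr_ge0 _) (sqr_ge0 _).
rewrite (h `|_|)// real_normK ?num_real// (h a)// (h b)// (h (a + b)) ?addr_ge0//.
have e : (a + b) ^+ 2 + (a - b) ^+ 2 = 2 * (a ^+ 2 + b ^+ 2) by ring.
rewrite e powRM ?addr_ge0 ?sqr_ge0// in h2.
have e2 : 2 `^ (p / 2) * 2 `^ (p / 2 - 1) = 2 `^ (p - 1) :> R.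
  by rewrite -powRD ?pnatr_eq0 ?implybT//; congr (_ `^ _); lra.
rewrite lerBrDr addrC (le_trans h2)// -e2 -mulrA.
by rewrite ler_wpM2l// powR_ge0.
Qed.

(** With [q = p * s], the power is at most [expR q], hence at most [1 / (1 - q)], and [(1 - q) * (1
    + q + 2 * q ^+ 2) = 1 + q ^+ 2 * (1 - 2 * q)] is at least 1. *)
Lemma powR_1D_le p s : 1 < p -> p * `|s| <= 1 / 2 ->
  (1 + s) `^ p <= 1 + p * s + 2 * p ^+ 2 * s ^+ 2.
Proof.
move=> p1 ps.
have [s1 s2] : - (1/2) <= p * s /\ p * s <= 1/2.
  by apply/andP; rewrite -ler_norml normrM gtr0_norm//; lra.
have s3 : -1 <= s by nra.
have : (1 + s) `^ p <= expR s `^ p.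
  by apply: ge0_ler_powR; rewrite ?nnegrE ?expR_ge1Dx//; lra.
rewrite -expRM mulrC => /le_trans; apply.
have := expR_ge1Dx (- (p * s)); rewrite expRN.
have E0 := expR_gt0 (p * s).
rewrite -[(expR _)^-1]div1r ler_pdivlMr// => h.
have -> : 2 * p ^+ 2 * s ^+ 2 = 2 * (p * s) ^+ 2 by ring.
move: h E0 s1 s2; move: (p * s) (expR _) => q E h E0 s1 s2.
have q2 : 0 <= q ^+ 2 * (1 - 2 * q) by rewrite mulr_ge0 ?sqr_ge0//; lra.
have h1 : (1 + - q) * (1 + q + 2 * q ^+ 2) >= 1 by lra.
have : (1 - q) * E <= (1 - q) * (1 + q + 2 * q ^+ 2) by lra.
by rewrite ler_pM2l//; lra.
Qed.

End power.

(** * Differentiability of convex functions *)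

Definition convex_real {R : realType} {X : normedModType R} (h : X -> R) :=
  forall x y (t : R), 0 <= t <= 1 ->
    h (t *: x + (1 - t) *: y) <= t * h x + (1 - t) * h y.

Definition locally_bounded_above {R : realType} {X : normedModType R}
    (h : X -> R) :=
  forall x, exists r B, 0 < r /\ forall v, `|v| <= r -> h (x + v) <= B.

Section convex.
Context {R : realType} {X : normedModType R}.
Implicit Types (h : X -> R) (x y u v w : X) (e t : R).

Definition second_diff h x v := h (x + v) + h (x - v) - 2 * h x.

Lemma scaler_halfD x : 2^-1 *: (x + x) = x.
Proof.
by rewrite scalerDr -scalerDl (_ : 2^-1 + 2^-1 = 1 :> R) ?scale1r//; lra.
Qed.

Lemma convex_real_mid h x y : convex_real h ->
  2 * h (2^-1 *: (x + y)) <= h x + h y.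
Proof.
move=> hc; have h01 : 0 <= (2^-1 : R) <= 1 by lra.
have := hc x y _ h01; have -> : 1 - 2^-1 = 2^-1 :> R by lra.
by rewrite -scalerDr; lra.
Qed.

Lemma second_diff_ge0 h x v : convex_real h -> 0 <= second_diff h x v.
Proof.
move=> /(@convex_real_mid h (x + v) (x - v)).
by rewrite addrACA subrr addr0 scaler_halfD /second_diff; lra.
Qed.

Lemma convex_continuous h : convex_real h -> locally_bounded_above h ->
  continuous h.
Proof.
move=> hc hb x; have [r [B [r0 hB]]] := hb x.
have Bx : h x <= B by rewrite -[x]addr0; apply: hB; rewrite normr0 ltW.
(* The bound on the decrease comes from writing [x] as a convex combination of [x - w] and
   [x + t *: w], the bound on the increase from convexity between [x] and [x + w]. *)
have key t w : 0 <= t <= 1 -> `|w| <= r ->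
    `|h x - h (x + t *: w)| <= t * (B - h x).
  move=> /andP[t0 t1] wr; rewrite ler_norml; apply/andP; split; last first.
    have := hc (x - w) (x + t *: w) (t / (1 + t)) => /(_ _)/wrap[].
      by rewrite divr_ge0 ?ler_pdivrMr; lra.
    have -> : 1 - t / (1 + t) = (1 + t)^-1 by field; rewrite gt_eqF//; lra.
    have -> : (t / (1 + t)) *: (x - w) + (1 + t)^-1 *: (x + t *: w) = x.
      rewrite mulrC -scalerA -scalerDr scalerBr addrCA addrNK.
      rewrite -[X in _ *: (X + _)]scale1r -scalerDl scalerA mulVf ?scale1r//.
      by rewrite gt_eqF//; lra.
    rewrite [t / _]mulrC -mulrA -mulrDr ler_pdivlMl; last lra.
    have : h (x - w) <= B by apply: hB; rewrite normrN.
    by nra.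
  have := hc (x + w) x t; rewrite t0 t1 => /(_ isT).
  rewrite scalerDr addrAC -scalerDl addrCA subrr addr0 scale1r.
  by have := hB w wr; nra.
apply/cvgrPdist_le => e e0.
pose d := r * Num.min 1 (e / (1 + (B - h x))).
have D0 : 0 < 1 + (B - h x) by lra.
have m0 : 0 < Num.min 1 (e / (1 + (B - h x))) by rewrite lt_min ltr01 divr_gt0.
have d0 : 0 < d by rewrite mulr_gt0.
apply/nbhs_normP; exists d => //= y /=.
set v := y - x; rewrite distrC -/v => /ltW vd.
have -> : y = x + v by rewrite addrCA subrr addr0.
set m := Num.min _ _ in d d0 vd m0.
have m1 : m <= 1 by rewrite ge_min lexx.
have -> : v = m *: (m^-1 *: v) by rewrite scalerA mulfV ?scale1r// gt_eqF.
apply: (le_trans (key _ _ _ _)).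
- by rewrite ltW.
- by rewrite normrZ gtr0_norm ?invr_gt0// ler_pdivrMl// mulrC.
- have : m <= e / (1 + (B - h x)) by rewrite ge_min lexx orbT.
  rewrite ler_pdivlMr//; nra.
Qed.

Lemma continuous_locally_bounded h : continuous h -> locally_bounded_above h.
Proof.
move=> hc x; have /cvgrPdist_lt/(_ 1 ltr01)/nbhs_normP[r /= r0 hr] := hc x.
exists (r / 2), (h x + 1); split => [|v vr]; first by rewrite divr_gt0.
have := hr (x + v); rewrite /= opprD addrA subrr add0r normrN.
move=> /(_ ltac:(lra)); rewrite ltr_norml; lra.
Qed.

(** * Differentiability at a point by way of one-sided directional derivatives *)

Section slope.
Variables (h : X -> R) (x : X).
Hypothesis hc : convex_real h.

Let slopes v := [set (h (x + t *: v) - h x) / t | t in [set t | 0 < t]].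
(** Slopes of a convex function increase with [t], so this infimum is the limit as [t] decreases to
    0: the one-sided directional derivative at [x]. *)
Let dir_der v := inf (slopes v).

Let slope_mono v s t : 0 < s -> s <= t ->
  (h (x + s *: v) - h x) / s <= (h (x + t *: v) - h x) / t.
Proof.
move=> s0 st; have t0 : 0 < t by lra.
rewrite ler_pdivrMr// mulrAC ler_pdivlMr//.
have st1 : 0 <= s / t <= 1 by rewrite divr_ge0 ?ler_pdivrMr ?mul1r//= ltW.
have := hc (x + t *: v) x st1.
rewrite scalerDr scalerA divfK ?gt_eqF// addrAC -scalerDl addrCA subrr addr0.
rewrite scale1r.
have : s / t * t = s by rewrite divfK// gt_eqF.
move: (s / t) => l lts; rewrite -lts; nra.
Qed.

Let slopes_lb v t : 0 < t -> h x - h (x - v) <= (h (x + t *: v) - h x) / t.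
Proof.
move=> t0; rewrite ler_pdivlMr//.
have t1 : 0 <= t / (1 + t) <= 1 by rewrite divr_ge0 ?ler_pdivrMr; lra.
have := hc (x - v) (x + t *: v) t1.
have -> : 1 - t / (1 + t) = (1 + t)^-1 by field; rewrite gt_eqF//; lra.
have -> : (t / (1 + t)) *: (x - v) + (1 + t)^-1 *: (x + t *: v) = x.
  rewrite mulrC -scalerA -scalerDr scalerBr addrCA addrNK.
  rewrite -[X in _ *: (X + _)]scale1r -scalerDl scalerA mulVf ?scale1r//.
  by rewrite gt_eqF//; lra.
rewrite [t / _]mulrC -mulrA -mulrDr ler_pdivlMl; last lra.
nra.
Qed.

Let slopes_has_lbound v : has_lbound (slopes v).
Proof. by exists (h x - h (x - v)) => _ /= [t t0 <-]; exact: slopes_lb. Qed.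

Let slopes_neq0 v : slopes v !=set0.
Proof. by exists ((h (x + 1 *: v) - h x) / 1); exists 1 => //=. Qed.

Let dir_der_le v t : 0 < t -> dir_der v <= (h (x + t *: v) - h x) / t.
Proof. by move=> t0; apply: ge_inf => //; exists t. Qed.

Let dir_der_ge v l : (forall t, 0 < t -> l <= (h (x + t *: v) - h x) / t) ->
  l <= dir_der v.
Proof. by move=> H; apply: lb_le_inf => // _ /= [t t0 <-]; exact: H. Qed.

Let dir_der_approx v e : 0 < e -> exists2 t0, 0 < t0 &
  forall t, 0 < t <= t0 -> (h (x + t *: v) - h x) / t <= dir_der v + e.
Proof.
move=> e0; have hinf := conj (slopes_neq0 v) (slopes_has_lbound v).
have [_ /= [s s0 <-] hs] := inf_adherent e0 hinf.
exists s => // t /andP[t0 ts]; apply: (le_trans (slope_mono v t0 ts)).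
exact: ltW.
Qed.

Let dir_derD_le v w : dir_der (v + w) <= dir_der v + dir_der w.
Proof.
apply/ler_addgt0Pr => e e0; have e20 : 0 < e / 2 by rewrite divr_gt0.
have [s s0 hs] := dir_der_approx v e20.
have [t t0 ht] := dir_der_approx w e20.
pose r := Num.min s t; have r0 : 0 < r by rewrite lt_min s0.
have := hs r; rewrite r0 ge_min lexx => /(_ isT).
have := ht r; rewrite r0 ge_min lexx orbT => /(_ isT).
rewrite !ler_pdivrMr// => h1 h2.
have r20 : 0 < r / 2 by rewrite divr_gt0.
apply: (le_trans (dir_der_le (v + w) r20)); rewrite ler_pdivrMr//.
have := @convex_real_mid h (x + r *: v) (x + r *: w) hc.
have -> : 2^-1 *: (x + r *: v + (x + r *: w)) = x + (r / 2) *: (v + w).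
  by rewrite addrACA -(scalerDr r) (scalerDr 2^-1 (x + x)) scaler_halfD
    scalerA [2^-1 * r]mulrC.
nra.
Qed.

Let dir_derZ t v : 0 < t -> dir_der (t *: v) = t * dir_der v.
Proof.
move=> t0; have half s w : 0 < s -> s * dir_der w <= dir_der (s *: w).
  move=> s0; apply: dir_der_ge => r r0.
  rewrite scalerA; have := @dir_der_le w (r * s) (mulr_gt0 r0 s0).
  rewrite invfM mulrA ler_pdivlMr//.
  by rewrite mulrC.
apply/eqP; rewrite eq_le half// andbT.
have := @half t^-1 (t *: v); rewrite invr_gt0 => /(_ t0).
by rewrite scalerA mulVf ?gt_eqF// scale1r ler_pdivrMl.
Qed.

Hypothesis hsmooth : forall e, 0 < e -> exists2 d, 0 < d &
  forall v, `|v| <= d -> second_diff h x v <= e * `|v|.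
Hypothesis hbdd : locally_bounded_above h.

(** Nonnegative second differences give one inequality. For the other, the slopes along [v] and
    [- v] at a common step add up to a second difference divided by that step, which [hsmooth] makes
    arbitrarily small. Oddness upgrades sublinearity of [dir_der] to linearity. *)
Let dir_derN v : dir_der (- v) = - dir_der v.
Proof.
apply/eqP; rewrite eq_le; apply/andP; split; last first.
  rewrite lerNl -[leLHS]mul1r; apply: dir_der_ge => t t0.
  rewrite mul1r; apply/ler_addgt0Pr => e e0.
  have [s s0 hs] := dir_der_approx (- v) e0.
  pose r := Num.min s t; have r0 : 0 < r by rewrite lt_min s0.
  have := hs r; rewrite r0 ge_min lexx => /(_ isT) h1.
  have h2 : (h (x + r *: v) - h x) / r <= (h (x + t *: v) - h x) / t.
    by apply: slope_mono; rewrite // ge_min lexx orbT.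
  have := second_diff_ge0 x (r *: v) hc; rewrite /second_diff.
  rewrite ler_pdivrMr// in h1; move: h2; set T := (_ / t); rewrite ler_pdivrMr//.
  rewrite scalerN in h1; nra.
rewrite -subr_le0 opprK; apply/ler_addgt0Pr => e e0; rewrite add0r.
(* Dividing by [1 + |v|] rather than [|v|] covers [v = 0] as well. *)
pose e' := e / (1 + `|v|).
have v1 : 0 < 1 + `|v| by have := normr_ge0 v; lra.
have e'0 : 0 < e' by rewrite divr_gt0.
have [d d0 hd] := hsmooth e'0.
pose t := d / (1 + `|v|); have t0 : 0 < t by rewrite divr_gt0.
have tv : `|t *: v| = t * `|v| by rewrite normrZ gtr0_norm.
have := hd (t *: v); rewrite tv => /(_ _)/wrap[].
  by rewrite /t mulrAC ler_pdivrMr// ler_pM2l//; lra.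
rewrite /second_diff => h1.
have h2 := dir_der_le v t0; have h3 := dir_der_le (- v) t0.
rewrite ler_pdivlMr// scalerN in h3; rewrite ler_pdivlMr// in h2.
have : e' * `|v| <= e by rewrite /e' mulrAC ler_pdivrMr// ler_pM2l//; lra.
rewrite -(ler_pM2r t0); nra.
Qed.

Let dir_derD v w : dir_der (v + w) = dir_der v + dir_der w.
Proof.
apply/eqP; rewrite eq_le dir_derD_le /=.
have := dir_derD_le (v + w) (- w); rewrite addrK dir_derN; lra.
Qed.

Let dir_der_linear : linear dir_der.
Proof.
move=> t v w; rewrite dir_derD; congr (_ + _).
have [t0|t0|->] := ltgtP t 0.
- by rewrite -[t]opprK scaleNr dir_derN dir_derZ ?oppr_gt0// scaleNr.
- exact: dir_derZ.
- by rewrite !scale0r; have := dir_derD 0 0; rewrite addr0; lra.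
Qed.

(** The linear map [dir_der] lies below the increments along both [v] and [- v], so the remainder of
    the first-order expansion lies between 0 and [second_diff h x v], which is little-o. Local
    boundedness of [h] above makes the map continuous. *)
Lemma convex_smooth_differentiable :
  differentiable h x /\ forall v, 'd h x v <= h (x + v) - h x.
Proof.
pose AM := GRing.isLinear.Build _ _ _ _ _ dir_der_linear.
pose A : {linear X -> R} := HB.pack dir_der AM.
have Ale v : A v <= h (x + v) - h x.
  by have := dir_der_le v ltr01; rewrite scale1r divr1.
have AN v : A (- v) = - A v := dir_derN v.
have Ac : continuous A.
  apply/linear_bounded_continuous.
  have [r [B [r0 hB]]] := hbdd x.
  exists (B - h x); split; first by rewrite num_real.
  move=> C BC; apply/nbhs_normP; exists r => //= v /=.
  rewrite sub0r normrN => /ltW vr; rewrite ler_norml.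
  have h1 := Ale v; have h2 := hB v vr.
  have := Ale (- v); rewrite AN => h3; have := hB (- v); rewrite normrN => /(_ vr).
  lra.
have Ad : h \o shift x = cst (h x) + A +o_ 0 id.
  apply/eqaddoP => e e0; have [d d0 hd] := hsmooth e0.
  apply/nbhs_normP; exists d => //= v /=; rewrite sub0r normrN => /ltW vd.
  rewrite [X in `|X| <= _](_ : _ = h (v + x) - (h x + A v))//.
  rewrite opprD addrA [v + x]addrC.
  have h1 := Ale v; have := Ale (- v); rewrite AN.
  have := hd v vd; rewrite /second_diff ger0_norm; lra.
have dE := diff_unique Ac Ad.
by split; [apply/diff_locallyP; rewrite dE|move=> v; rewrite dE].
Qed.

End slope.

(** Three supporting inequalities are added: at [y] along [w], at [x] along [y - x], and at [x]
    along [- (y - x + w)]. They bound the difference of the derivatives on [w] by the second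
    difference at [x] along [y - x + w], of length at most [2 * |x - y|]. *)
Lemma diff_dist_le h x y e : differentiable h x -> differentiable h y ->
  (forall v, 'd h x v <= h (x + v) - h x) ->
  (forall v, 'd h y v <= h (y + v) - h y) ->
  (forall w, `|w| <= 2 * `|x - y| -> second_diff h x w <= e) ->
  forall v, `|v| <= 1 -> `|'d h x v - 'd h y v| * `|x - y| <= e.
Proof.
move=> dx dy hx hy he.
have key v : `|v| <= 1 -> ('d h y v - 'd h x v) * `|x - y| <= e.
  move=> v1; set t := `|x - y|.
  pose w := t *: v; have wt : `|w| <= t.
    by rewrite normrZ ger0_norm ?normr_ge0// ler_piMr ?normr_ge0.
  have -> : ('d h y v - 'd h x v) * t = 'd h y w - 'd h x w.
    by rewrite /w !linearZ /= mulrBl scalerN; congr (_ - _); exact: mulrC.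
  have h1 := hy w.
  have h2 : second_diff h x (y - x + w) <= e.
    by apply: he; rewrite (le_trans (ler_normD _ _))// distrC -/t; lra.
  have h3 := hx (y - x).
  have h4 : - ('d h x (y - x) + 'd h x w) <= h (x - (y - x + w)) - h x.
    by rewrite -linearD -linearN; exact: hx.
  rewrite /second_diff in h2.
  have e1 : x + (y - x + w) = y + w by rewrite addrA addrCA subrr addr0.
  have e2 : x + (y - x) = y by rewrite addrCA subrr addr0.
  rewrite e1 in h2; rewrite e2 in h3; lra.
move=> v v1; have h1 := key v v1; have := key (- v).
rewrite normrN => /(_ v1).
have -> : 'd h y (- v) = - 'd h y v by exact: linearN.
have -> : 'd h x (- v) = - 'd h x v by exact: linearN.
move: h1; move: ('d h x v : R) ('d h y v : R) `|x - y| => a b t.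
by case: (ger0P (a - b)) => _; lra.
Qed.

End convex.

(** * Smoothness of powers of the norm *)

Section norm.
Context {R : realType}.
Variable p : R.
Hypothesis hp : (1 : R) < p.
Context {X : normedModType R}.
Variable N : X -> R.
Hypothesis hN : equivalent_norm N.
Implicit Types (x y z u v w : X) (r s t d e : R).

Lemma eqnormD x y : N (x + y) <= N x + N y.
Proof. by case: hN. Qed.

Lemma eqnormZ t x : N (t *: x) = `|t| * N x.
Proof. by case: hN. Qed.

Lemma eqnormN x : N (- x) = N x.
Proof. by rewrite -scaleN1r eqnormZ normrN1 mul1r. Qed.

Lemma eqnorm0 : N 0 = 0.
Proof. by rewrite -(scale0r 0) eqnormZ normr0 mul0r. Qed.

Lemma eqnorm_ge0 x : 0 <= N x.
Proof. by have := eqnormD x (- x); rewrite subrr eqnorm0 eqnormN; lra. Qed.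

Lemma eqnormB x y : N (x - y) = N (y - x).
Proof. by rewrite -eqnormN opprB. Qed.

Lemma eqnorm_dist x y : `|N x - N y| <= N (x - y).
Proof.
rewrite ler_norml; have := eqnormD (x - y) y; have := eqnormD (y - x) x.
rewrite !subrK (eqnormB y x); lra.
Qed.

Lemma eqnorm_unit x : 0 < N x -> N ((N x)^-1 *: x) = 1.
Proof. by move=> x0; rewrite eqnormZ gtr0_norm ?invr_gt0// mulVf// gt_eqF. Qed.

Lemma eqnorm_unitK x : 0 < N x -> N x *: ((N x)^-1 *: x) = x.
Proof. by move=> x0; rewrite scalerA mulfV ?scale1r// gt_eqF. Qed.

Definition eqnorm_pow x := N x `^ p.

Lemma eqnorm_pow_convex : convex_real eqnorm_pow.
Proof.
have p1 := hp.
move=> x y t t01; rewrite /eqnorm_pow; case/andP: t01 => t0 t1.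
apply: (@le_trans _ _ ((t * N x + (1 - t) * N y) `^ p)).
  apply: ge0_ler_powR; rewrite ?nnegrE ?eqnorm_ge0//; first lra.
    by have := eqnorm_ge0 x; have := eqnorm_ge0 y; nra.
  apply: (le_trans (eqnormD _ _)); rewrite !eqnormZ (ger0_norm t0) ger0_norm//; lra.
by apply: powR_conv; rewrite ?eqnorm_ge0 ?t0//; lra.
Qed.

Lemma eqnorm_pow_locally_bounded : locally_bounded_above eqnorm_pow.
Proof.
have p1 := hp.
case: hN => _ _ [c [C [c0 C0 cC]]] x; exists 1, ((N x + C) `^ p).
split=> // v v1; apply: ge0_ler_powR; rewrite ?nnegrE ?eqnorm_ge0//; first lra.
  by rewrite addr_ge0 ?eqnorm_ge0// ltW.
apply: (le_trans (eqnormD _ _)); rewrite lerD2l.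
by have := (cC v).2; nra.
Qed.

Lemma eqnorm_pow_le x t : N x <= t -> eqnorm_pow x <= t `^ p.
Proof.
have p1 := hp.
move=> xt; have := eqnorm_ge0 x => x0.
by apply: ge0_ler_powR; rewrite ?nnegrE; lra.
Qed.

(** Splits off the directions that cannot be normalized in the estimates that follow. *)
Lemma second_diff_pow0 x v : N v = 0 -> second_diff eqnorm_pow x v <= 0.
Proof.
have p1 := hp.
move=> v0; have h1 : eqnorm_pow (x + v) <= eqnorm_pow x.
  by apply: eqnorm_pow_le; have := eqnormD x v; lra.
have h2 : eqnorm_pow (x - v) <= eqnorm_pow x.
  by apply: eqnorm_pow_le; have := eqnormD x (- v); rewrite eqnormN; lra.
by rewrite /second_diff; lra.
Qed.

Lemma second_diff_pow_far x v t : 0 <= t -> N x <= t * N v ->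
  second_diff eqnorm_pow x v <= 2 * (1 + t) `^ p * N v `^ p.
Proof.
have p1 := hp.
move=> t0 xt; have v0 := eqnorm_ge0 v.
have h1 : eqnorm_pow (x + v) <= ((1 + t) * N v) `^ p.
  by apply: eqnorm_pow_le; have := eqnormD x v; lra.
have h2 : eqnorm_pow (x - v) <= ((1 + t) * N v) `^ p.
  by apply: eqnorm_pow_le; have := eqnormD x (- v); rewrite eqnormN; lra.
have h3 : 0 <= eqnorm_pow x by exact: powR_ge0.
by rewrite /second_diff -mulrA -powRM//; lra.
Qed.

(** The modulus only speaks of unit vectors; homogeneity extends it to all pairs, with [N v / N x]
    as parameter. *)
Lemma smoothness_modulus_ge x v : 0 < N x -> 0 < N v ->
  N (x + v) + N (x - v) - 2 * N x <=
  2 * N x * smoothness_modulus N (N v / N x).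
Proof.
move=> x0 v0; set t := N v / N x; have t0 : 0 < t by rewrite divr_gt0.
set x' := (N x)^-1 *: x; set v' := (N v)^-1 *: v.
have xE : x = N x *: x' by rewrite eqnorm_unitK.
have vE : v = N x *: (t *: v').
  by rewrite scalerA mulrC divfK ?gt_eqF// eqnorm_unitK.
have -> : N (x + v) = N x * N (x' + t *: v').
  by rewrite [in LHS]xE [in LHS]vE -scalerDr eqnormZ gtr0_norm.
have -> : N (x - v) = N x * N (x' - t *: v').
  by rewrite [in LHS]xE [in LHS]vE -scalerBr eqnormZ gtr0_norm.
suff : (N (x' + t *: v') + N (x' - t *: v')) / 2 - 1 <= smoothness_modulus N t.
  by nra.
apply: ub_le_sup; last first.
  by exists x', v'; split; rewrite ?eqnorm_unit.
(* The triangle inequality bounds the set by [t], so its [sup] is a genuine upper bound and not a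
   default value. *)
exists t => _ [y [w [y1 w1 ->]]].
have := eqnormD y (t *: w); have := eqnormD y (- (t *: w)).
rewrite eqnormN eqnormZ gtr0_norm// y1 w1; lra.
Qed.

Lemma second_diff_pow_near x v : 0 < N x -> 0 < N v -> 2 * p * N v <= N x ->
  second_diff eqnorm_pow x v <= N x `^ p *
    (2 * p * smoothness_modulus N (N v / N x) + 4 * p ^+ 2 * (N v / N x) ^+ 2).
Proof.
have p1 := hp.
move=> x0 v0 vx; have H := smoothness_modulus_ge x0 v0.
set r := N x in x0 vx H *; set t := N v in v0 vx H *.
have key y : `|N y - r| <= t ->
    eqnorm_pow y <= r `^ p * (1 + p * ((N y - r) / r) + 2 * p ^+ 2 * (t / r) ^+ 2).
  move=> yr; set s := (N y - r) / r.
  have rs : r * s = N y - r by rewrite mulrC divfK// gt_eqF.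
  have s_le : `|s| <= t / r.
    by rewrite normrM (gtr0_norm (_ : 0 < r^-1)) ?ler_pM2r ?invr_gt0.
  have -> : eqnorm_pow y = r `^ p * (1 + s) `^ p.
    rewrite -powRM; [|lra|]; last first.
      have : 0 <= r * (1 + s) by rewrite mulrDr mulr1 rs; have := eqnorm_ge0 y; lra.
      by rewrite pmulr_rge0.
    by rewrite mulrDr mulr1 rs addrC subrK.
  rewrite ler_pM2l ?powR_gt0//.
  have ps : p * `|s| <= 1 / 2.
    have : p * (t / r) <= 1 / 2 by rewrite mulrA ler_pdivrMr//; lra.
    by nra.
  apply: (le_trans (powR_1D_le hp ps)); rewrite lerD2l.
  rewrite ler_wpM2l//; first by rewrite mulr_ge0 ?sqr_ge0.
  by rewrite -[s ^+ 2]real_normK ?num_real// lerXn2r ?nnegrE// divr_ge0 ?ltW.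
have h1 := key (x + v); have h2 := key (x - v).
have := eqnorm_dist (x + v) x; have := eqnorm_dist (x - v) x.
rewrite addrAC subrr add0r eqnormN => /h2 {}h2.
rewrite addrAC subrr add0r => /h1 {}h1.
rewrite /second_diff.
have rp : 0 < r `^ p by rewrite powR_gt0.
have e1 : p * ((N (x + v) - r) / r) + p * ((N (x - v) - r) / r) <=
    2 * p * smoothness_modulus N (t / r).
  rewrite -mulrDr -mulrDl mulrA ler_pdivrMr//.
  have := H; move: (smoothness_modulus _ _) => m; nra.
have -> : eqnorm_pow x = r `^ p by [].
rewrite -subr_ge0 in e1; have := mulr_ge0 (ltW rp) e1.
move: h1 h2; lra.
Qed.

Lemma powR_le_1D (q r : R) : 0 <= q <= p -> 0 <= r -> r `^ q <= 1 + r `^ p.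
Proof.
have p1 := hp.
move=> /andP[q0 qp] r0; have [r1|r1] := leP r 1.
  have : r `^ q <= 1 `^ q by apply: ge0_ler_powR; rewrite ?nnegrE.
  by have := powR_ge0 r p; rewrite powR1; lra.
have : r `^ q <= r `^ p by apply: ler_powR => //; lra.
by have := powR_ge0 r p; lra.
Qed.

(** Two regimes. Where [N x] is at most a multiple of [N v], the crude bound is of order [N v]^
    p[, small compared with]N v[because]p > 1[. Elsewhere]N v / N
    x[is small and the modulus applies, giving]e * N v * N x [^ (p - 1)]. *)
Lemma second_diff_pow_unif : uniformly_smooth N ->
  forall e, 0 < e -> exists2 d, 0 < d & forall x v, N v <= d ->
    second_diff eqnorm_pow x v <= e * N v * (1 + eqnorm_pow x).
Proof.
have p1 := hp.
move=> hU e e0; have p0 : 0 < p by lra.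
have e1 : 0 < e / (8 * p) by rewrite divr_gt0// mulr_gt0.
move/cvgrPdist_le/(_ _ e1) : hU => [/= d0 /= d00 hd0].
(* The three bounds serve the estimate of the modulus, the condition of the second-order expansion,
   and the quadratic term. *)
pose d := Num.min (d0 / 2) (Num.min (1 / (2 * p)) (e / (8 * p ^+ 2))).
have dd : 0 < d.
  rewrite /d !lt_min; apply/and3P; split; apply: divr_gt0 => //.
    by rewrite mulr_gt0.
  by rewrite mulr_gt0// exprn_gt0.
have [dd0 [dp de]] : d <= d0 / 2 /\ d <= 1 / (2 * p) /\ d <= e / (8 * p ^+ 2).
  by rewrite /d !ge_min !lexx !orbT.
pose A := d^-1; have A0 : 0 < A by rewrite invr_gt0.
pose C := 2 * (1 + A) `^ p; have C0 : 0 < C by rewrite mulr_gt0 ?powR_gt0//; lra.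
exists ((e / C) `^ (p - 1)^-1); first by rewrite powR_gt0// divr_gt0.
move=> x v vle; have v0 := eqnorm_ge0 v.
have P0 : 0 <= eqnorm_pow x := powR_ge0 _ _.
have [vE|vN] := eqVneq (N v) 0.
  by rewrite vE mulr0 mul0r second_diff_pow0.
have {vN} v0 : 0 < N v by rewrite lt_neqAle eq_sym vN.
have [xfar|xnear] := leP (N x) (A * N v).
  apply: (le_trans (second_diff_pow_far (ltW A0) xfar)).
  rewrite -(@mulr_powRB1 _ (N v) p)// -/C; last by rewrite ltW.
  have : N v `^ (p - 1) <= e / C.
    apply: (@le_trans _ _ (((e / C) `^ (p - 1)^-1) `^ (p - 1))).
      by apply: ge0_ler_powR; rewrite ?nnegrE ?powR_ge0//; lra.
    have pn : p - 1 != 0 by rewrite subr_eq0 gt_eqF.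
    by rewrite -powRrM mulVf// powRr1// divr_ge0// ltW.
  rewrite ler_pdivlMr// -(ler_pM2r v0) => h.
  have : 0 <= e * N v * eqnorm_pow x by rewrite !mulr_ge0// ltW.
  by move: h; lra.
have x0 : 0 < N x by apply: le_lt_trans xnear; rewrite mulr_ge0 ?ltW.
have td : N v / N x <= d.
  by rewrite ler_pdivrMr// -ler_pdivrMl//; exact: ltW.
set t := N v / N x in td *; have t0 : 0 < t by rewrite divr_gt0.
have tx : t * N x = N v by rewrite divfK// gt_eqF.
have px : 2 * p * N v <= N x.
  have : t <= 1 / (2 * p) by lra.
  rewrite ler_pdivlMr ?mulr_gt0//; nra.
apply: (le_trans (second_diff_pow_near x0 v0 px)); rewrite -/t.
have : smoothness_modulus N t <= e / (8 * p) * t.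
  have := hd0 t; rewrite /= sub0r normrN gtr0_norm// => /(_ ltac:(lra) t0).
  rewrite sub0r normrN ler_norml => /andP[_]; rewrite ler_pdivrMr//.
move=> h1; have h2 : t ^+ 2 <= e / (8 * p ^+ 2) * t by rewrite expr2; nra.
have h3 : 2 * p * smoothness_modulus N t + 4 * p ^+ 2 * t ^+ 2 <= e * t.
  have a1 : 2 * p * smoothness_modulus N t <= 2 * p * (e / (8 * p) * t).
    by rewrite ler_pM2l// mulr_gt0.
  have a2 : 4 * p ^+ 2 * t ^+ 2 <= 4 * p ^+ 2 * (e / (8 * p ^+ 2) * t).
    by rewrite ler_pM2l// mulr_gt0// exprn_gt0.
  have b1 : 2 * p * (e / (8 * p) * t) = e / 4 * t by field; rewrite gt_eqF.
  have b2 : 4 * p ^+ 2 * (e / (8 * p ^+ 2) * t) = e / 2 * t.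
    by field; rewrite gt_eqF.
  have : 0 < e * t by rewrite mulr_gt0.
  lra.
apply: (@le_trans _ _ (N x `^ p * (e * t))); first by rewrite ler_wpM2l ?powR_ge0.
rewrite -(@mulr_powRB1 _ (N x) p (ltW x0) p0).
have -> : N x * N x `^ (p - 1) * (e * t) = e * N v * N x `^ (p - 1).
  by rewrite -tx; ring.
apply: ler_wpM2l; first by rewrite mulr_ge0// ltW.
apply: powR_le_1D; last exact: ltW.
by apply/andP; split; lra.
Qed.

(** The same two regimes. In the near one [t = N v / N x] is at most 1, so [t]^ (1 + a)[and]t ^+
    2[are both at most]t [^ q], and [N x]^ p * t [^ q] becomes [N v]^ q * N x [^ (p - q)]. *)
Lemma second_diff_pow_hoelder (a q : R) : 0 < a <= 1 ->
  smoothness_power_type N (1 + a) -> 1 <= q -> q <= p -> q <= 1 + a ->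
  exists2 C, 0 < C & forall x v, second_diff eqnorm_pow x v <=
    C * N v `^ q * (N x `^ (p - q) + N v `^ (p - q)).
Proof.
have p1 := hp.
move=> /andP[a0 a1] [C0 C00 hC0] q1 qp qa.
pose C1 := 2 * p * C0 + 4 * p ^+ 2; pose C2 := 2 * (1 + 2 * p) `^ p.
have C10 : 0 < C1 by rewrite addr_gt0// !mulr_gt0 ?exprn_gt0//; lra.
have C20 : 0 < C2 by rewrite mulr_gt0 ?powR_gt0//; lra.
exists (C1 + C2) => [|x v]; first by rewrite addr_gt0.
have X0 := powR_ge0 (N x) (p - q); have V0 := powR_ge0 (N v) (p - q).
have Q0 := powR_ge0 (N v) q.
have A1 := mulr_ge0 (mulr_ge0 (ltW C10) Q0) X0.
have A2 := mulr_ge0 (mulr_ge0 (ltW C10) Q0) V0.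
have A3 := mulr_ge0 (mulr_ge0 (ltW C20) Q0) X0.
have A4 := mulr_ge0 (mulr_ge0 (ltW C20) Q0) V0.
have v0 := eqnorm_ge0 v; have [vE|vN] := eqVneq (N v) 0.
  apply: (le_trans (second_diff_pow0 x vE)).
  apply: mulr_ge0; last exact: addr_ge0.
  by apply: mulr_ge0 => //; rewrite addr_ge0 ?(ltW C10) ?(ltW C20).
have {vN} v0 : 0 < N v by rewrite lt_neqAle eq_sym vN.
have [xfar|xnear] := leP (N x) (2 * p * N v).
  apply: (le_trans (second_diff_pow_far _ xfar)); first lra.
  rewrite -/C2 (_ : N v `^ p = N v `^ q * N v `^ (p - q)); last first.
    by rewrite -powRD_gt0// addrC subrK.
  by move: A1 A2 A3 A4; lra.
have x0 : 0 < N x by apply: le_lt_trans xnear; rewrite mulr_ge0 ?(ltW v0)//; lra.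
apply: (le_trans (second_diff_pow_near x0 v0 (ltW xnear))).
set t := N v / N x; have t0 : 0 < t by rewrite divr_gt0.
have t1 : t <= 1 by rewrite ler_pdivrMr// mul1r; nra.
have tle s : q <= s -> t `^ s <= t `^ q.
  move=> qs; rewrite -(subrK q s) powRD_gt0//.
  rewrite ler_piMl ?powR_ge0//.
  apply: (@le_trans _ _ (1 `^ (s - q))); last by rewrite powR1.
  by apply: ge0_ler_powR; rewrite ?nnegrE; lra.
have h1 : 2 * p * smoothness_modulus N t + 4 * p ^+ 2 * t ^+ 2 <= C1 * t `^ q.
  have -> : C1 * t `^ q = 2 * p * (C0 * t `^ q) + 4 * p ^+ 2 * t `^ q.
    by rewrite /C1; ring.
  apply: lerD; apply: ler_wpM2l.
  - by rewrite mulr_ge0//; lra.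
  - by rewrite (le_trans (hC0 t t0))// ler_pM2l// tle.
  - by rewrite mulr_ge0// sqr_ge0.
  - by rewrite -powR_mulrn; [apply: tle; lra|exact: ltW].
have h2 : N x `^ p * t `^ q = N v `^ q * N x `^ (p - q).
  rewrite -[in N v `^ q](divfK (_ : N x != 0) (N v)) ?gt_eqF// -/t.
  rewrite (powRM _ (ltW t0) (ltW x0)) -mulrA -powRD_gt0//.
  by rewrite [q + _]addrC subrK mulrC.
apply: (@le_trans _ _ (N x `^ p * (C1 * t `^ q))).
  by rewrite ler_wpM2l ?powR_ge0.
by rewrite mulrCA h2; move: A1 A2 A3 A4; lra.
Qed.

End norm.

(** * Convexity gaps of powers of the norm *)

Section gap.
Context {R : realType}.
Variable p : R.
Hypothesis hp : (1 : R) < p.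
Context {X : normedModType R}.
Variable N : X -> R.
Hypothesis hN : equivalent_norm N.
Implicit Types (x y z u v w : X) (r s t d e : R).

(** The cost [c x y] of the regularization, before multiplication by [n]. *)
Definition conv_gap x y := 2 `^ (p - 1) * (N x `^ p + N y `^ p) - N (x + y) `^ p.

Lemma conv_gapC x y : conv_gap x y = conv_gap y x.
Proof. by rewrite /conv_gap [x + y]addrC [N x `^ p + _]addrC. Qed.

Lemma conv_gap_ge x y :
  2 `^ (p - 1) * (N x `^ p + N y `^ p) - (N x + N y) `^ p <= conv_gap x y.
Proof.
have p1 := hp; rewrite /conv_gap lerD2l lerN2.
apply: ge0_ler_powR; rewrite ?nnegrE ?addr_ge0 ?(eqnorm_ge0 hN)//; first lra.
exact: eqnormD.
Qed.

Lemma conv_gap_ge0 x y : 0 <= conv_gap x y.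
Proof.
have p1 := hp; apply: le_trans (conv_gap_ge x y).
by rewrite subr_ge0 powR_mid ?(eqnorm_ge0 hN)//; lra.
Qed.

Local Notation unit x := ((N x)^-1 *: x).

Lemma eqnormZ_unit t x : 0 < N x -> N (t *: unit x) = `|t|.
Proof. by move=> x0; rewrite (eqnormZ hN) (eqnorm_unit hN x0) mulr1. Qed.

(** For [N y <= N x], the sum [x + y] is [N y] times the sum of the unit vectors plus a multiple of
    [unit x], so [N (x + y)] falls short of [N x + N y] by at least [2 * N y] times the midpoint
    defect. The defect then passes to the powers. *)
Lemma conv_gap_unit x y b : 0 < b -> b <= N x -> b <= N y ->
  2 * b `^ p * (1 - N (unit x + unit y) / 2) <= conv_gap x y.
Proof.
have p1 := hp; move=> b0.
wlog yx : x y / N y <= N x.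
  move=> H bx b_y; have [yx|/ltW xy] := leP (N y) (N x); first exact: H.
  by rewrite conv_gapC [unit x + _]addrC; exact: H.
move=> bx b_y; have x0 : 0 < N x by lra.
have y0 : 0 < N y by lra.
set k := 1 - N (unit x + unit y) / 2.
have k0 : 0 <= k.
  have := eqnormD hN (unit x) (unit y).
  by rewrite (eqnorm_unit hN x0) (eqnorm_unit hN y0) /k; lra.
have h1 : N (x + y) <= N x + N y - 2 * N y * k.
  have -> : x + y = N y *: (unit x + unit y) + (N x - N y) *: unit x.
    rewrite scalerDr (eqnorm_unitK y0) scalerBl (eqnorm_unitK x0).
    by rewrite [RHS]addrC addrA subrK.
  apply: (le_trans (eqnormD hN _ _)).
  rewrite (eqnormZ_unit _ x0) (eqnormZ hN (N y)) (gtr0_norm y0) ger0_norm; last lra.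
  by rewrite /k; lra.
have xy0 := eqnorm_ge0 hN (x + y).
have h2 := @powR_lipschitz_below _ p (N x + N y) (N (x + y)) (ltW p1) xy0
  (eqnormD hN x y).
have h3 := @powR_mid _ p (N x) (N y) (ltW p1) (ltW x0) (ltW y0).
have h4 : b `^ (p - 1) <= (N x + N y) `^ (p - 1).
  by apply: ge0_ler_powR; rewrite ?nnegrE; lra.
have h5 : 2 * b * k <= N x + N y - N (x + y).
  have : b * k <= N y * k by rewrite ler_wpM2r.
  by lra.
have h6 : 2 * b * k * b `^ (p - 1) <=
    (N x + N y - N (x + y)) * (N x + N y) `^ (p - 1).
  by apply: ler_pM; rewrite ?powR_ge0 ?mulr_ge0//; lra.
have -> : 2 * b `^ p * k = 2 * b * k * b `^ (p - 1).
  by rewrite -(@mulr_powRB1 _ b p); [ring|exact: ltW|lra].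
by rewrite /conv_gap; lra.
Qed.

(** Splits a distance into an angular part, scaled by either norm, and a radial part. *)
Lemma eqnormB_unit x y b : 0 < N x -> 0 < N y -> (b = N x \/ b = N y) ->
  N (x - y) <= b * N (unit x - unit y) + `|N x - N y|.
Proof.
move=> x0 y0 [->|->].
- have -> : x - y = N x *: (unit x - unit y) + (N x - N y) *: unit y.
    rewrite scalerBr scalerBl (eqnorm_unitK x0) (eqnorm_unitK y0).
    by rewrite addrA subrK.
  apply: (le_trans (eqnormD hN _ _)).
  by rewrite (eqnormZ_unit _ y0) (eqnormZ hN (N x)) (gtr0_norm x0).
- have -> : x - y = N y *: (unit x - unit y) + (N x - N y) *: unit x.
    rewrite scalerBr scalerBl (eqnorm_unitK x0) (eqnorm_unitK y0).
    by rewrite [RHS]addrC addrA subrK.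
  apply: (le_trans (eqnormD hN _ _)).
  by rewrite (eqnormZ_unit _ x0) (eqnormZ hN (N y)) (gtr0_norm y0).
Qed.

(** Distant [z] and [y] differ in norm or in direction. A radial difference of [r / 2] is handled by
    the scalar gap; otherwise both norms are at least [r / 4] and the directions are [r / (2 * M)]
    apart. The condition on directions is asked at [unit z] only, so that uniform and local
    convexity can both supply it. *)
Lemma conv_gap_modulus M r d : 0 < M -> 0 < r -> 0 < d ->
  exists2 D, 0 < D & forall z y, N z <= M -> r <= N (z - y) ->
    (0 < N z -> forall w, N w = 1 -> r / (2 * M) <= N (unit z - w) ->
      d <= 1 - N (unit z + w) / 2) -> D <= conv_gap z y.
Proof.
have p1 := hp; move=> M0 r0 d0.
have [D D0 hD] := powR_gap p1 M0 (divr_gt0 r0 (ltr0Sn _ 1)).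
exists (Num.min D (2 * (r / 4) `^ p * d)).
  by rewrite lt_min D0/= !mulr_gt0// powR_gt0// divr_gt0.
move=> z y zM rzy hd; have z0 := eqnorm_ge0 hN z; have y0 := eqnorm_ge0 hN y.
rewrite ge_min; have [far|near] := leP (r / 2) `|N z - N y|.
  by rewrite (le_trans _ (conv_gap_ge z y)) ?hD ?z0.
have hD2 := eqnormD hN z (- y); rewrite (eqnormN hN) in hD2.
move: (near); rewrite ltr_norml => /andP[n1 n2].
have zr : r / 4 <= N z by lra.
have yr : r / 4 <= N y by lra.
have {}z0 : 0 < N z by lra.
have {}y0 : 0 < N y by lra.
have h := eqnormB_unit z0 y0 (or_introl erefl).
have dk : d <= 1 - N (unit z + unit y) / 2.
  apply: hd => //; first exact: eqnorm_unit.
  rewrite ler_pdivrMr ?mulr_gt0//.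
  have := eqnorm_ge0 hN (unit z - unit y).
  have : N z * N (unit z - unit y) <= M * N (unit z - unit y).
    by rewrite ler_wpM2r// (eqnorm_ge0 hN).
  by lra.
apply/orP; right.
have r4 : 0 < r / 4 by lra.
apply: le_trans (conv_gap_unit r4 zr yr).
by rewrite ler_wpM2l// mulr_ge0// powR_ge0.
Qed.

Lemma uniform_gap : uniformly_convex N -> forall M r, 0 < M -> 0 < r ->
  exists2 D, 0 < D & forall z y, N z <= M -> r <= N (z - y) ->
    D <= conv_gap z y.
Proof.
have p1 := hp; move=> hU M r M0 r0.
pose e := Num.min 2 (r / (2 * M)).
have e02 : 0 < e <= 2.
  by rewrite lt_min ge_min lexx/= andbT ltr0Sn divr_gt0// mulr_gt0.
have [d d0 hd] : exists2 d : R, 0 < d & (d%:E <= convexity_modulus N e)%E.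
  (* An infinite modulus exceeds every real, so 1 serves as [d]. *)
  have := hU e e02; case: (convexity_modulus N e) => [m||]//.
    by rewrite lte_fin => m0; exists m.
  by exists 1; rewrite ?leey.
have [D D0 hD] := conv_gap_modulus M0 r0 d0.
exists D => // z y zM rzy; apply: hD => // z0 w w1 h.
rewrite -lee_fin; apply: (le_trans hd); apply: ereal_inf_lbound.
exists (unit z), w; split => //; first exact: eqnorm_unit.
by rewrite (le_trans _ h)// ge_min lexx orbT.
Qed.

(** If every [d = 1 / (k + 1)] fails, the witnesses [w k] satisfy [N (u + w k) --> 2] while staying
    at distance [e] from [u], against local uniform convexity. *)
Lemma luc_modulus u : locally_uniformly_convex N -> N u = 1 ->
  forall e, 0 < e -> exists2 d, 0 < d & forall w, N w = 1 -> e <= N (u - w) ->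
    d <= 1 - N (u + w) / 2.
Proof.
move=> hL u1 e e0; apply: contrapT => H.
have /choice[w hw] : forall k : nat, exists w, [/\ N w = 1, e <= N (u - w) &
    1 - N (u + w) / 2 < k.+1%:R^-1].
  move=> k; apply: contrapT => Hk; apply: H; exists k.+1%:R^-1 => // w w1 ew.
  by rewrite leNgt; apply/negP => lt; apply: Hk; exists w.
have /hL : N (u + w k) @[k --> \oo] --> (2 : R).
  apply/cvgrPdist_lt => d d0; near=> k.
  have [w1 _ hk] := hw k; have := eqnormD hN u (w k); rewrite u1 w1 => h2.
  rewrite ger0_norm; last lra.
  have : k.+1%:R^-1 < d / 2.
    by near: k; apply: near_infty_natSinv_lt (PosNum (divr_gt0 d0 (ltr0Sn _ 1))).
  by move: (k.+1%:R^-1) hk => q; lra.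
move=> /(_ u1 (fun k => let: And3 h _ _ := hw k in h)).
move/cvgrPdist_lt => /(_ e e0)[k _ /(_ k (leqnn k))] /=.
have [_ h _] := hw k; rewrite sub0r normrN ger0_norm ?(eqnorm_ge0 hN)//; lra.
Unshelve. all: by end_near. Qed.

(** The modulus at [unit x] carries over to [unit z] for [z] close to [x], at the price of halving
    the distance and the defect. *)
Lemma local_gap : locally_uniformly_convex N -> forall x r, 0 < r ->
  exists s D, [/\ 0 < s, 0 < D & forall z y, N (x - z) <= s ->
    r <= N (z - y) -> D <= conv_gap z y].
Proof.
move=> hL x r r0; have x0 := eqnorm_ge0 hN x.
have [xE|xN] := eqVneq (N x) 0.
  (* Around the origin the radius [r / 8] makes the condition on directions vacuous: it would
     require unit vectors at distance 4. *)
  have r8 : 0 < r / 8 by rewrite divr_gt0.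
  have [D D0 hD] := conv_gap_modulus r8 r0 ltr01.
  exists (r / 8), D; split => // z y xz zy; apply: hD => //.
    by have := eqnorm_dist hN x z; rewrite xE ler_norml; lra.
  move=> z0 w w1; have := eqnormD hN (unit z) (- w).
  rewrite (eqnormN hN) w1 (eqnorm_unit hN z0) => h.
  have -> : r / (2 * (r / 8)) = 4 by field; rewrite gt_eqF.
  by lra.
have {xN} x0 : 0 < N x by rewrite lt_neqAle eq_sym xN.
pose M := 2 * N x; have M0 : 0 < M by rewrite mulr_gt0.
pose e := r / (2 * M); have e0 : 0 < e by rewrite divr_gt0// mulr_gt0.
have [d d0 hd] := luc_modulus hL (eqnorm_unit hN x0) (divr_gt0 e0 (ltr0Sn _ 1)).
have [D D0 hD] := conv_gap_modulus M0 r0 (divr_gt0 d0 (ltr0Sn _ 1)).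
pose k := Num.min (e / 2) d; have k0 : 0 < k by rewrite lt_min d0 divr_gt0.
have [ke kd] : k <= e / 2 /\ k <= d by rewrite /k !ge_min !lexx orbT.
exists (Num.min (N x) (N x * k / 2)), D; split => //.
  by rewrite lt_min x0 divr_gt0// mulr_gt0.
move=> z y; rewrite le_min => /andP[xz1 xz2] zy.
have := eqnorm_dist hN x z; rewrite ler_norml => /andP[n1 n2].
apply: hD => //; first by rewrite /M; lra.
move=> z0 w w1 hw; rewrite -/e in hw.
(* Both [N (x - z)] and the difference of the norms are at most [N x * k / 2]. *)
have kxz : N (unit x - unit z) <= k.
  rewrite -(ler_pM2l x0).
  have -> : N x * N (unit x - unit z) = N (x - N x *: unit z).
    have -> : x - N x *: unit z = N x *: (unit x - unit z).
      by rewrite scalerBr (eqnorm_unitK x0).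
    by rewrite (eqnormZ hN (N x)) gtr0_norm.
  have -> : x - N x *: unit z = (x - z) + (N z - N x) *: unit z.
    by rewrite scalerBl (eqnorm_unitK z0) addrA subrK.
  apply: (le_trans (eqnormD hN _ _)).
  rewrite (eqnormZ_unit _ z0) distrC.
  by have := eqnorm_dist hN x z; lra.
have shift v v' v'' : v + v' + (v'' - v) = v'' + v'.
  by rewrite [LHS]addrC addrA subrK.
have h1 : e / 2 <= N (unit x - w).
  have := eqnormD hN (unit z - w) (unit x - unit z).
  have := eqnormD hN (unit x - w) (unit z - unit x).
  by rewrite !shift (eqnormB hN (unit z) (unit x)); lra.
have := hd w w1 h1; have := eqnormD hN (unit x + w) (unit z - unit x).
rewrite shift (eqnormB hN (unit z)); lra.
Qed.

(** Either [z] is far from [x], and the first gap is large, or [z] is close enough to [x0] for the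
    local gap at [z], and the second gap is large since [y] remains at distance [r / 2] from [z]. *)
Lemma local_gap2 : locally_uniformly_convex N -> forall x0 r, 0 < r ->
  exists s D, [/\ 0 < s, 0 < D & forall x z y, N (x0 - x) <= s ->
    r <= N (x - y) -> D <= conv_gap x z + conv_gap z y].
Proof.
move=> hL x0 r r0; have r2 : 0 < r / 2 by rewrite divr_gt0.
have [s [D [s0 D0 hD]]] := local_gap hL x0 r2.
pose s' := Num.min (s / 2) (r / 2).
have s'0 : 0 < s' by rewrite lt_min !divr_gt0.
have [sa sb] : s' <= s / 2 /\ s' <= r / 2 by rewrite /s' !ge_min !lexx orbT.
have [t [E [t0 E0 hE]]] := local_gap hL x0 s'0.
exists (Num.min t (s / 2)), (Num.min D E); split.
- by rewrite lt_min t0 divr_gt0.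
- by rewrite lt_min D0.
move=> x z y; rewrite le_min => /andP[xt xs] xy.
have [xz|/ltW xz] := leP s' (N (x - z)).
  have := hE x z xt xz; have := conv_gap_ge0 z y.
  have : Num.min D E <= E by rewrite ge_min lexx orbT.
  by lra.
have := hD z y; have := conv_gap_ge0 x z.
have : Num.min D E <= D by rewrite ge_min lexx.
have h1 := eqnormD hN (x0 - x) (x - z); rewrite addrA subrK in h1.
have h2 := eqnormD hN (x - z) (z - y); rewrite addrA subrK in h2.
by move=> h3 h4 /(_ ltac:(lra) ltac:(lra)); lra.
Qed.

Lemma uniform_gap2 : uniformly_convex N -> forall M r, 0 < M -> 0 < r ->
  exists2 D, 0 < D & forall x z y, N x <= M -> r <= N (x - y) ->
    D <= conv_gap x z + conv_gap z y.
Proof.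
move=> hU M r M0 r0; have r2 : 0 < r / 2 by rewrite divr_gt0.
have Mr : 0 < M + r / 2 by rewrite addr_gt0.
have [D D0 hD] := uniform_gap hU Mr r2.
exists D => // x z y xM xy; have c1 := conv_gap_ge0 x z.
have c2 := conv_gap_ge0 z y.
have [xz|/ltW xz] := leP (r / 2) (N (x - z)).
  by have := hD x z ltac:(lra) xz; lra.
have h1 := eqnormD hN (z - x) x; rewrite subrK (eqnormB hN) in h1.
have h2 := eqnormD hN (x - z) (z - y); rewrite addrA subrK in h2.
by have := hD z y ltac:(lra) ltac:(lra); lra.
Qed.

(** The radial part of [x - y] is controlled by the scalar Clarkson inequality, the angular part by
    the modulus of convexity. *)
Lemma power_gap : convexity_power_type N p -> 2 <= p ->
  exists2 D, 0 < D & forall x y, D * N (x - y) `^ p <= conv_gap x y.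
Proof.
have p1 := hp; move=> [C C0 hC] p2.
pose K := 2 `^ (p - 1) * (1 / (2 * C) + 1).
have K0 : 0 < K by rewrite mulr_gt0 ?powR_gt0// addr_gt0// divr_gt0// mulr_gt0.
exists K^-1 => [|x y]; first by rewrite invr_gt0.
rewrite ler_pdivrMl//; have x0 := eqnorm_ge0 hN x; have y0 := eqnorm_ge0 hN y.
have h1 : `|N x - N y| `^ p <= conv_gap x y.
  by apply: le_trans (conv_gap_ge x y); exact: powR_clarkson.
have K1 : 1 <= K.
  have : 1 <= 2 `^ (p - 1) :> R.
    have /(@ler_powR _ 2 (ler1n _ 2)) : 0 <= p - 1 by lra.
    by rewrite powRr0.
  have : 0 < 1 / (2 * C) by rewrite divr_gt0// mulr_gt0.
  by rewrite /K; nra.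
have c0 := conv_gap_ge0 x y.
have triv : N (x - y) <= `|N x - N y| -> N (x - y) `^ p <= K * conv_gap x y.
  move=> h; apply: (@le_trans _ _ (1 * conv_gap x y)); last exact: ler_wpM2r.
  rewrite mul1r; apply: le_trans h1.
  by apply: ge0_ler_powR; rewrite ?nnegrE ?(eqnorm_ge0 hN)//; lra.
have hD2 := eqnormD hN x (- y); rewrite (eqnormN hN) in hD2.
have [xE|xN] := eqVneq (N x) 0.
  by apply: triv; rewrite xE sub0r normrN ger0_norm//; lra.
have [yE|yN] := eqVneq (N y) 0.
  by apply: triv; rewrite yE subr0 ger0_norm//; lra.
have {xN} {}x0 : 0 < N x by rewrite lt_neqAle eq_sym xN.
have {yN} {}y0 : 0 < N y by rewrite lt_neqAle eq_sym yN.
pose b := Num.min (N x) (N y).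
have b0 : 0 < b by rewrite lt_min x0.
have [bx b_y] : b <= N x /\ b <= N y by rewrite /b !ge_min !lexx orbT.
have bxy : b = N x \/ b = N y.
  by rewrite /b; have [] := leP (N x) (N y); [left|right].
set k := N (unit x - unit y).
have k0 : 0 <= k := eqnorm_ge0 hN _.
have h2 : 2 * C * (b * k) `^ p <= conv_gap x y.
  apply: le_trans (conv_gap_unit b0 bx b_y).
  rewrite powRM ?(ltW b0)//.
  rewrite (_ : 2 * C * _ = 2 * b `^ p * (C * k `^ p)); last by ring.
  apply: ler_wpM2l; first by rewrite mulr_ge0 ?powR_ge0.
  have := eqnormD hN (unit x) (unit y); have := eqnormD hN (unit x) (- unit y).
  rewrite (eqnormN hN) (eqnorm_unit hN x0) (eqnorm_unit hN y0) -/k => k2 h.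
  have [kE|kN] := eqVneq k 0.
    by rewrite kE powR0 ?gt_eqF//; lra.
  have {kN} kp : 0 < k by rewrite lt_neqAle eq_sym kN.
  have /hC : 0 < k <= 2 by rewrite kp/=; lra.
  rewrite -lee_fin => /le_trans; apply; apply: ereal_inf_lbound.
  by exists (unit x), (unit y); split => //; exact: eqnorm_unit.
have h3 : N (x - y) `^ p <=
    2 `^ (p - 1) * ((b * k) `^ p + `|N x - N y| `^ p).
  apply: le_trans (powR_mid _ _ _) => //; last by rewrite mulr_ge0// ltW.
    apply: ge0_ler_powR; rewrite ?nnegrE ?(eqnorm_ge0 hN)//; first lra.
      by rewrite addr_ge0// mulr_ge0// ltW.
    exact: eqnormB_unit.
  exact: ltW.
apply: (le_trans h3); rewrite /K -mulrA ler_wpM2l ?powR_ge0// mulrDl !mul1r.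
by rewrite lerD// ler_pdivlMl// mulr_gt0.
Qed.

Lemma power_gap2 : convexity_power_type N p -> 2 <= p ->
  exists2 D, 0 < D & forall x z y,
    D * N (x - y) `^ p <= conv_gap x z + conv_gap z y.
Proof.
have p1 := hp; move=> hC p2; have [D D0 hD] := power_gap hC p2.
exists (D / 2 `^ (p - 1)) => [|x z y]; first by rewrite divr_gt0// powR_gt0.
apply: (@le_trans _ _ (D * (N (x - z) `^ p + N (z - y) `^ p))); last first.
  by rewrite mulrDr lerD.
rewrite -mulrA ler_pM2l// ler_pdivrMl ?powR_gt0//.
apply: le_trans (powR_mid (ltW p1) (eqnorm_ge0 hN _) (eqnorm_ge0 hN _)).
apply: ge0_ler_powR; rewrite ?nnegrE ?addr_ge0 ?(eqnorm_ge0 hN)//; first lra.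
by have := eqnormD hN (x - z) (z - y); rewrite addrA subrK.
Qed.

End gap.

(** * The convex envelope of the regularization *)

Section convex_operations.
Context {R : realType} {X : normedModType R}.
Implicit Types (h g : X -> R) (x y v : X).

Lemma convex_real_shift h v : convex_real h -> convex_real (fun x => h (x + v)).
Proof.
move=> hc x y t t01; apply: le_trans (hc _ _ t t01).
suff -> : t *: x + (1 - t) *: y + v = t *: (x + v) + (1 - t) *: (y + v) by [].
by rewrite !scalerDr addrACA -scalerDl [t + _]addrC subrK scale1r.
Qed.

Lemma convex_realD h g : convex_real h -> convex_real g ->
  convex_real (fun x => h x + g x).
Proof.
move=> hc gc x y t t01; have := hc x y t t01; have := gc x y t t01; lra.
Qed.

Lemma convex_realZ h (a b : R) : 0 <= a -> convex_real h ->
  convex_real (fun x => a * h x + b).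
Proof.
move=> a0 hc x y t t01; have := hc x y t t01.
by rewrite -subr_ge0 => /(mulr_ge0 a0); lra.
Qed.

End convex_operations.

Section envelope.
Context {R : realType} {X : normedModType R}.
Implicit Types (F : X -> \bar R) (h : X -> R) (x y : X).

Lemma convex_envelope_le F x : (convex_envelope F x <= F x)%E.
Proof. by apply: ge_ereal_sup => _ /= [h [_ _ _ hF] <-]; exact: hF. Qed.

Lemma convex_envelope_ge F h x : convex_real h -> continuous h ->
  (forall y, ((h y)%:E <= F y)%E) -> ((h x)%:E <= convex_envelope F x)%E.
Proof.
move=> hc hcont hF; apply: ereal_sup_ubound; exists (EFin \o h) => //=; split.
- by split=> [y|]; [exact: ltNyr|exists 0; exact: ltry].
- by move=> y z t t01 /=; rewrite lee_fin; exact: hc.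
- move=> y a /=; rewrite lte_fin => ay; exists [set z | a < h z] => [|z].
    exact: (hcont y _ (lt_nbhsr ay)).
  by rewrite /= lte_fin.
- exact: hF.
Qed.

Lemma convex_envelope_convex F : econvex (convex_envelope F).
Proof.
move=> x y t t01; apply: ge_ereal_sup => _ /= [h hF <-].
have [_ hc _ _] := hF; have /andP[t0 t1] := t01.
apply: (le_trans (hc x y t t01)); apply: leeD; apply: lee_wpmul2l.
- by rewrite lee_fin.
- by apply: ereal_sup_ubound; exists h.
- by rewrite lee_fin subr_ge0.
- by apply: ereal_sup_ubound; exists h.
Qed.

End envelope.

(** * The regularization of an arbitrary function: upper bound and lower bounds *)

Section regularization.
Context {R : realType}.
Variable p : R.
Hypothesis hp : (1 : R) < p.
Context {X : normedModType R}.
Variable N : X -> R.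
Hypothesis hN : equivalent_norm N.
Variable n : nat.
Implicit Types (f : X -> \bar R) (x y z v : X).

Local Notation K := (2 `^ (p - 1) * n%:R).
Local Notation gap := (conv_gap p N).
Local Notation Np := (eqnorm_pow p N).
Local Notation G x y := (n%:R * gap x y + K * Np x).

Lemma g_regE f x : g_reg N p n f x =
  (ereal_inf [set f y + (n%:R * gap x y)%:E | y in setT] + (K * Np x)%:E)%E.
Proof.
rewrite /g_reg; congr (ereal_inf _ + _)%E; apply: eq_imagel => y _.
by congr (_ + _%:E)%E; rewrite /conv_gap; ring.
Qed.

Lemma g_reg_ge f x (a : R) :
  (forall y, ((a - K * Np x)%:E <= f y + (n%:R * gap x y)%:E)%E) ->
  (a%:E <= g_reg N p n f x)%E.
Proof.
move=> H; rewrite g_regE -leeBlDr// -EFinB.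
by apply: le_ereal_inf_tmp => _ [y _ <-].
Qed.

Lemma g_reg_le f x y : (g_reg N p n f x <= f y + (G x y)%:E)%E.
Proof.
rewrite g_regE EFinD addeA leeD2r//.
by apply: ereal_inf_lbound; exists y.
Qed.

Lemma reg_cost_ge0 x y : 0 <= n%:R * gap x y.
Proof. by rewrite mulr_ge0// conv_gap_ge0. Qed.

Lemma reg_weight_ge0 : 0 <= K.
Proof. by rewrite mulr_ge0// powR_ge0. Qed.

Lemma eqnorm_pow_ge0 x : 0 <= Np x.
Proof. exact: powR_ge0. Qed.

Lemma eqnorm_pow_continuous : continuous Np.
Proof.
by apply: convex_continuous; [exact: eqnorm_pow_convex|
  exact: eqnorm_pow_locally_bounded].
Qed.

Lemma conv_gap_diag x : gap x x = 0.
Proof.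
have p1 := hp; rewrite /conv_gap.
have -> : N (x + x) = 2 * N x.
  by rewrite -mulr2n -scaler_nat (eqnormZ hN) ger0_norm.
rewrite powRM ?(eqnorm_ge0 hN)// -(@mulr_powRB1 _ 2 p)//; last lra.
by ring.
Qed.

(** The choice [y = x] in the infimum costs nothing, as the gap vanishes on the diagonal. *)
Lemma Delta_reg_le f x : (Delta_reg N p n f x <= f x)%E.
Proof.
have p1 := hp; rewrite /Delta_reg leeBlDr//.
apply: (le_trans (convex_envelope_le _ _)); apply: (le_trans (g_reg_le _ _ x)).
by rewrite conv_gap_diag mulr0 add0r.
Qed.

Lemma eqnorm_pow_differentiable : uniformly_smooth N -> forall x,
  differentiable Np x /\ forall v, 'd Np x v <= Np (x + v) - Np x.
Proof.
case: (hN) => _ _ [c [C [c0 C0 cC]]] hU x.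
apply: convex_smooth_differentiable.
- exact: eqnorm_pow_convex.
- move=> e e0; pose e' := e / (C * (1 + Np x)).
  have D0 : 0 < C * (1 + Np x) by rewrite mulr_gt0// ltr_pwDl// eqnorm_pow_ge0.
  have [d d0 hd] := second_diff_pow_unif hp hN hU (divr_gt0 e0 D0).
  exists (d / C) => [|v vd]; first by rewrite divr_gt0.
  have [_ vC] := cC v; apply: (le_trans (hd x v _)).
    by rewrite (le_trans vC)// mulrC -ler_pdivlMr.
  rewrite -mulrA.
  apply: (@le_trans _ _ (e / (C * (1 + Np x)) * (C * `|v| * (1 + Np x)))).
    apply: ler_wpM2l; first by rewrite ltW// divr_gt0.
    by apply: ler_wpM2r => //; rewrite addr_ge0// eqnorm_pow_ge0.
  have -> // : e / (C * (1 + Np x)) * (C * `|v| * (1 + Np x)) = e * `|v|.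
  have P0 : 0 < 1 + Np x by rewrite ltr_pwDl// eqnorm_pow_ge0.
  by field; rewrite !gt_eqF.
- exact: eqnorm_pow_locally_bounded.
Qed.

Lemma Delta_reg_ge f x (M : R) : uniformly_smooth N ->
  (forall z y, (M%:E <= f y + (n%:R * (gap x z + gap z y))%:E)%E) ->
  (M%:E <= Delta_reg N p n f x)%E.
Proof.
have p1 := hp; move=> hU H.
have [dN dNle] := eqnorm_pow_differentiable hU x.
pose h z := M + K * (Np x + 'd Np x (z - x)).
have <- : h x - K * Np x = M.
  rewrite /h; have -> : 'd Np x (x - x) = 0 by rewrite subrr linear0.
  by rewrite addr0 addrK.
rewrite /Delta_reg EFinB; apply: leeB => //; apply: convex_envelope_ge.
- move=> y z t t01; rewrite /h.
  have -> : t *: y + (1 - t) *: z - x = t *: (y - x) + (1 - t) *: (z - x).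
    by rewrite !scalerBr addrACA -opprD -scalerDl [t + _]addrC subrK scale1r.
  have -> : 'd Np x (t *: (y - x) + (1 - t) *: (z - x)) =
      t * 'd Np x (y - x) + (1 - t) * 'd Np x (z - x).
    by rewrite linearD !linearZ.
  by rewrite le_eqVlt; apply/orP; left; apply/eqP; ring.
- move=> y; rewrite /h; apply: cvgD; first exact: cvg_cst.
  apply: cvgM; first exact: cvg_cst.
  apply: cvgD; first exact: cvg_cst.
  apply: (@cvg_comp _ _ _ (fun z => z - x) ('d Np x)).
    by apply: cvgB; [exact: cvg_id|exact: cvg_cst].
  by apply: diff_continuous.
move=> z; apply: g_reg_ge => y.
suff hz : h z - K * Np z <= M - n%:R * gap x z.
  apply: (@le_trans _ _ (M - n%:R * gap x z)%:E); first by rewrite lee_fin.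
  rewrite EFinB leeBlDr// -addeA -EFinD -mulrDr [gap z y + _]addrC.
  exact: H.
(* The supporting inequality at [x] is used at the midpoint [w] instead of [z]: since [N (x + z)]^
   p[is]2 [^ p * Np w], this brings in the extra term [gap x z]. *)
pose w := 2^-1 *: (x + z).
have ww : x + z = w + w.
  by rewrite /w -scalerDl (_ : 2^-1 + 2^-1 = 1 :> R) ?scale1r//; lra.
have xw : x + 2^-1 *: (z - x) = w.
  rewrite -[X in X + _]scaler_halfD -scalerDr; congr (_ *: _).
  by rewrite -addrA [x + (z - x)]addrC subrK.
have h1 : 'd Np x (z - x) <= 2 * (Np w - Np x).
  have := dNle (2^-1 *: (z - x)); rewrite xw linearZ /=.
  by rewrite -[_ *: 'd Np x _]/(_ * _); lra.
have h2 := conv_gap_diag w; rewrite /conv_gap -ww -/(Np w) in h2.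
have P0 : 0 <= 2 `^ (p - 1) :> R := powR_ge0 _ _.
have h3 : 2 `^ (p - 1) * (Np x + 'd Np x (z - x) - Np z) <= - gap x z.
  rewrite -subr_ge0 in h1; have := mulr_ge0 P0 h1.
  by rewrite /conv_gap -/(Np x) -/(Np z); lra.
have := ler_wpM2l (ler0n R n) h3; rewrite /h; lra.
Qed.

End regularization.

(** * The envelope as a finite continuous convex function, and its second differences *)

Section regularization_of_bounded_below.
Context {R : realType}.
Variable p : R.
Hypothesis hp : (1 : R) < p.
Context {X : normedModType R}.
Variable N : X -> R.
Hypothesis hN : equivalent_norm N.
Variable n : nat.
Variable f : X -> \bar R.
Hypothesis f_proper : proper_fun f.
Variable m : R.
Hypothesis f_ge : forall x, (m%:E <= f x)%E.
Implicit Types (x y z v : X) (h : X -> R).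

Local Notation K := (2 `^ (p - 1) * n%:R).
Local Notation gap := (conv_gap p N).
Local Notation Np := (eqnorm_pow p N).
Local Notation G x y := (n%:R * gap x y + K * Np x).

(** Taking [fine] loses nothing: the envelope lies between [m + K * Np x] and the finite values
    given by a point where [f] is finite. *)
Definition reg_envelope x : R := fine (convex_envelope (g_reg N p n f) x).

Let env_ge x : ((m + K * Np x)%:E <= convex_envelope (g_reg N p n f) x)%E.
Proof.
pose h x := K * Np x + m.
rewrite addrC; apply: (@convex_envelope_ge _ _ _ h).
- by apply: convex_realZ; [exact: reg_weight_ge0|exact: eqnorm_pow_convex].
- move=> y; apply: cvgD; last exact: cvg_cst.
  by apply: cvgM; [exact: cvg_cst|exact: eqnorm_pow_continuous].
move=> y; apply: g_reg_ge => z; rewrite /h addrAC subrr add0r.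
by rewrite -[leLHS]adde0 leeD// lee_fin reg_cost_ge0.
Qed.

Let env_le x y : (convex_envelope (g_reg N p n f) x <= f y + (G x y)%:E)%E.
Proof. by apply: le_trans (convex_envelope_le _ _) _; exact: g_reg_le. Qed.

Lemma reg_envelopeE x :
  convex_envelope (g_reg N p n f) x = (reg_envelope x)%:E.
Proof.
rewrite fineK// fin_numElt (lt_le_trans _ (env_ge x)) ?ltNyr//=.
have [y fy] := f_proper.2; apply: (le_lt_trans (env_le x y)).
by rewrite lte_add_pinfty ?ltry.
Qed.

Lemma reg_envelope_le x y : ((reg_envelope x)%:E <= f y + (G x y)%:E)%E.
Proof. by rewrite -reg_envelopeE; exact: env_le. Qed.

Lemma reg_envelope_convex : convex_real reg_envelope.
Proof.
move=> x y t t01; have := @convex_envelope_convex _ _ (g_reg N p n f) x y t t01.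
by rewrite !reg_envelopeE -!EFinM -EFinD lee_fin.
Qed.

Lemma reg_envelope_max h x : convex_real h -> continuous h ->
  (forall z y, ((h z)%:E <= f y + (G z y)%:E)%E) -> h x <= reg_envelope x.
Proof.
move=> hc hcont H; rewrite -lee_fin -reg_envelopeE.
apply: convex_envelope_ge => // z; apply: g_reg_ge => y.
by rewrite EFinB leeBlDr// -addeA -EFinD.
Qed.

Lemma reg_envelope_bounded (M : R) : exists B : R,
  forall x, N x <= M -> reg_envelope x <= B.
Proof.
have p1 := hp; have [y fy] := f_proper.2.
have fyE : (f y = (fine (f y))%:E)%E.
  by rewrite fineK// fin_numElt f_proper.1 fy.
exists (fine (f y) + (n%:R * (2 `^ (p - 1) * (M `^ p + Np y)) + K * M `^ p)).
move=> x xM; have := reg_envelope_le x y; rewrite fyE -EFinD lee_fin.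
move=> /le_trans; apply; rewrite lerD2l.
have xp : Np x <= M `^ p by exact: eqnorm_pow_le.
have P0 : 0 <= 2 `^ (p - 1) :> R := powR_ge0 _ _.
apply: lerD; last by rewrite ler_wpM2l// reg_weight_ge0.
rewrite ler_wpM2l// /conv_gap -/(Np x) -/(Np y).
have := ler_wpM2l P0 xp; have : 0 <= N (x + y) `^ p by exact: powR_ge0.
lra.
Qed.

Lemma reg_envelope_locally_bounded : locally_bounded_above reg_envelope.
Proof.
case: (hN) => _ _ [c [C [c0 C0 cC]]] x.
have [B hB] := reg_envelope_bounded (N x + C).
exists 1, B; split => // v v1; apply: hB; apply: (le_trans (eqnormD hN _ _)).
rewrite lerD2l; apply: (le_trans (cC v).2).
by rewrite -[leRHS]mulr1 ler_wpM2l// ltW.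
Qed.

Lemma reg_envelope_continuous : continuous reg_envelope.
Proof.
exact: convex_continuous reg_envelope_convex reg_envelope_locally_bounded.
Qed.

(** The average of the two translates of the envelope exceeds [f y + G z y] by at most
    [s * (m + K * Np z) + B]. As [m + K * Np z] is itself below [f y + G z y], subtracting [B] and
    dividing by [1 + s] gives a convex minorant, which maximality puts below the envelope. *)
Lemma second_diff_envelope (s B : R) v : 0 <= s ->
  (forall x, K * second_diff Np x v <= s * (m + K * Np x) + B) ->
  forall x, second_diff reg_envelope x v <= 2 * (s * reg_envelope x + B).
Proof.
have p1 := hp; move=> s0 H x.
have s1 : 0 < 1 + s by lra.
pose psi x := (1 + s)^-1 *
  (2^-1 * (reg_envelope (x + v) + reg_envelope (x - v)) + 0) +
  - ((1 + s)^-1 * B).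
have : psi x <= reg_envelope x.
  apply: reg_envelope_max.
  - apply: convex_realZ; first by rewrite invr_ge0 ltW.
    apply: convex_realZ; first by rewrite invr_ge0.
    by apply: convex_realD; apply: convex_real_shift; exact: reg_envelope_convex.
  - have hshift w : continuous (fun x => reg_envelope (x + w)).
      move=> y; apply: (@cvg_comp _ _ _ (fun z => z + w) reg_envelope).
        by apply: cvgD; [exact: cvg_id|exact: cvg_cst].
      exact: reg_envelope_continuous.
    move=> y; apply: cvgD; last exact: cvg_cst.
    apply: cvgM; first exact: cvg_cst.
    apply: cvgD; last exact: cvg_cst.
    apply: cvgM; first exact: cvg_cst.
    by apply: cvgD; exact: hshift.
  - move=> z y; have [fy|fy] := eqVneq (f y) +oo%E.
      by rewrite fy addye ?leey.
    have fyE : (f y = (fine (f y))%:E)%E.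
      by rewrite fineK// fin_numElt f_proper.1 ltey.
    have my := f_ge y.
    have h1 := reg_envelope_le (z + v) y; have h2 := reg_envelope_le (z - v) y.
    move: my h1 h2; rewrite fyE -!EFinD !lee_fin; set r := fine (f y) => my h1 h2.
    have d0 := second_diff_ge0 (z + y) v (eqnorm_pow_convex hp hN).
    have hz := H z.
    have g0 := reg_cost_ge0 hp hN n z y.
    rewrite /psi -mulrBr ler_pdivrMl// addr0.
    have nd0 := mulr_ge0 (ler0n R n) d0.
    (* The second difference of [G] in its first variable is [2 * K] times that of [Np] at [z] minus
       [n] times that of [Np] at [z + y]; the subtracted term is nonnegative and is dropped. *)
    have h3 : reg_envelope (z + v) + reg_envelope (z - v) <=
        2 * (r + G z y) + 2 * (K * second_diff Np z v).
      have -> : 2 * (r + G z y) + 2 * (K * second_diff Np z v) =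
          (r + G (z + v) y) + (r + G (z - v) y) + n%:R * second_diff Np (z + y) v.
        rewrite /second_diff /conv_gap -/(Np z) -/(Np y) -/(Np (z + y)).
        rewrite -/(Np (z + v)) -/(Np (z - v)) [z + y + v]addrAC [z + y - v]addrAC.
        by rewrite /eqnorm_pow; ring.
      by lra.
    have h4 := ler_wpM2l s0 (lerD my g0).
    by lra.
rewrite /psi -mulrBr ler_pdivrMl// addr0 /second_diff; lra.
Qed.

End regularization_of_bounded_below.

(** * Smoothness classes *)

Section smoothness_classes.
Context {R : realType} {X : normedModType R}.
Implicit Types (h : X -> R) (x y v w : X) (A : set X).

Lemma bounded_setW A : bounded_set A -> exists2 M : R, 0 < M &
  forall x, A x -> `|x| <= M.
Proof.
move=> [M [Mreal hM]]; exists (1 + `|M|) => [|x Ax].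
  by rewrite ltr_pwDl// normr_ge0.
by apply: hM => //; rewrite (le_lt_trans (ler_norm _))// ltrDr.
Qed.

Lemma derivative_dist_le h x y (e : R) :
  (forall v, `|v| <= 1 -> `|'d h x v - 'd h y v| <= e) ->
  derivative_dist h x y <= e.
Proof.
move=> H; apply: ge_sup => [|_ /= [v v1 <-]]; last exact: H.
by exists (`|'d h x 0 - 'd h y 0|), 0 => //=; rewrite normr0.
Qed.

Lemma normrBB_le (a b c d e : R) : `|a - b| <= e -> `|c - d| <= e ->
  `|a - c - (b - d)| <= 2 * e.
Proof.
move=> h1 h2; have -> : a - c - (b - d) = (a - b) - (c - d) by ring.
by apply: le_trans (ler_normB _ _) _; lra.
Qed.

Lemma second_diffZ (a : R) h x v :
  second_diff (fun z => a * h z) x v = a * second_diff h x v.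
Proof. by rewrite /second_diff; ring. Qed.

Section difference.
Variables h1 h2 : X -> R.
Hypotheses (c1 : convex_real h1) (c2 : convex_real h2).
Hypotheses (b1 : locally_bounded_above h1) (b2 : locally_bounded_above h2).
Hypothesis h12 : forall x (e : R), 0 < e -> exists2 d : R, 0 < d &
  forall v, `|v| <= d ->
    second_diff h1 x v <= e * `|v| /\ second_diff h2 x v <= e * `|v|.

Let d1 x : differentiable h1 x /\ forall v, 'd h1 x v <= h1 (x + v) - h1 x.
Proof.
apply: convex_smooth_differentiable => // e e0.
by have [d d0 hd] := h12 x e0; exists d => // v /hd[].
Qed.

Let d2 x : differentiable h2 x /\ forall v, 'd h2 x v <= h2 (x + v) - h2 x.
Proof.
apply: convex_smooth_differentiable => // e e0.
by have [d d0 hd] := h12 x e0; exists d => // v /hd[].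
Qed.

Lemma differentiable_convex_diff x : differentiable (fun z => h1 z - h2 z) x.
Proof. by apply: differentiableB; [exact: (d1 x).1|exact: (d2 x).1]. Qed.

Lemma derivative_dist_convex_diff x y (e : R) : 0 <= e ->
  (forall w, `|w| <= 2 * `|x - y| -> second_diff h1 x w <= e * `|x - y| /\
    second_diff h2 x w <= e * `|x - y|) ->
  derivative_dist (fun z => h1 z - h2 z) x y <= 2 * e.
Proof.
move=> e0 H; apply: derivative_dist_le => v v1.
have E z : 'd (fun z => h1 z - h2 z) z v = 'd h1 z v - 'd h2 z v.
  by have := @diffB _ _ _ h1 h2 z (d1 z).1 (d2 z).1 => /(congr1 (@^~ v)).
rewrite !E.
have [->|xy] := eqVneq x y; first by rewrite subrr normr0 mulr_ge0.
have t0 : 0 < `|x - y| by rewrite normr_gt0 subr_eq0.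
have k1 := diff_dist_le (d1 x).1 (d1 y).1 (d1 x).2 (d1 y).2
  (fun w hw => (H w hw).1) v1.
have k2 := diff_dist_le (d2 x).1 (d2 y).1 (d2 x).2 (d2 y).2
  (fun w hw => (H w hw).2) v1.
have cancel u : u * `|x - y| <= e * `|x - y| -> u <= e by rewrite ler_pM2r.
by apply: normrBB_le; [exact: cancel k1|exact: cancel k2].
Qed.

Lemma C1u_bounded_convex_diff :
  (forall M (e : R), 0 < M -> 0 < e -> exists2 d : R, 0 < d &
    forall x v, `|x| <= M -> `|v| <= d ->
      second_diff h1 x v <= e * `|v| /\ second_diff h2 x v <= e * `|v|) ->
  C1u_bounded_real (fun z => h1 z - h2 z).
Proof.
move=> H; split => [x|A Ab e e0]; first exact: differentiable_convex_diff.
have [M M0 hM] := bounded_setW Ab.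
(* Increments have length up to [2 * |x - y|] and two functions contribute, so [e / 8] ends up as
   [e / 2]. *)
have e8 : 0 < e / 8 by rewrite divr_gt0.
have [d d0 hd] := H M _ M0 e8; exists (d / 2) => [|x y Ax Ay xy].
  by rewrite divr_gt0.
have -> : e = 2 * (e / 2) by rewrite mulrC divfK.
apply: (@le_lt_trans _ _ (2 * (e / 4))); last lra.
apply: derivative_dist_convex_diff => [|w wxy]; first by rewrite divr_ge0// ltW.
have [||k1 k2] := hd x w; [exact: hM|lra|].
have : e / 8 * `|w| <= e / 8 * (2 * `|x - y|) by rewrite ler_pM2l.
by split; lra.
Qed.

(** One factor [|x - y|] of the second-order bound is spent in passing to derivatives, which leaves
    the exponent [b]. *)
Lemma derivative_hoelder_convex_diff A (b C : R) : 0 < b -> 0 <= C ->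
  (forall x y w, A x -> A y -> `|w| <= 2 * `|x - y| ->
     second_diff h1 x w <= C * `|w| `^ (1 + b) /\
     second_diff h2 x w <= C * `|w| `^ (1 + b)) ->
  derivative_hoelder_on A b (fun z => h1 z - h2 z).
Proof.
move=> b0 C0 H; exists (2 * (C * 2 `^ (1 + b))) => x y Ax Ay.
rewrite -mulrA; apply: derivative_dist_convex_diff => [|w wxy].
  by rewrite !mulr_ge0 ?powR_ge0.
have [k1 k2] := H x y w Ax Ay wxy.
have : C * `|w| `^ (1 + b) <= C * 2 `^ (1 + b) * `|x - y| `^ b * `|x - y|.
  apply: (@le_trans _ _ (C * (2 * `|x - y|) `^ (1 + b))).
    apply: ler_wpM2l => //; apply: ge0_ler_powR; rewrite ?nnegrE ?mulr_ge0//.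
    by lra.
  rewrite powRM// -(@mulr_powRB1 _ `|x - y| (1 + b))//; last lra.
  by rewrite [1 + b - 1]addrAC subrr add0r; lra.
by split; lra.
Qed.

End difference.
End smoothness_classes.

(** * Differentiability classes of the regularization *)

Section regularity.
Context {R : realType}.
Variable p : R.
Hypothesis hp : (1 : R) < p.
Context {X : normedModType R}.
Variable N : X -> R.
Hypothesis hN : equivalent_norm N.
Hypothesis hU : uniformly_smooth N.
Variable n : nat.
Variable f : X -> \bar R.
Hypothesis f_proper : proper_fun f.
Variable m : R.
Hypothesis f_ge : forall x, (m%:E <= f x)%E.
Implicit Types (x y z v : X) (h : X -> R).

Local Notation K := (2 `^ (p - 1) * n%:R).
Local Notation Np := (eqnorm_pow p N).
Local Notation phi := (reg_envelope p N n f).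
Local Notation KNp := (fun x => K * Np x).

Lemma Delta_regE : Delta_reg N p n f = EFin \o (fun x => phi x - K * Np x).
Proof.
by apply/funext => x; rewrite /Delta_reg (reg_envelopeE hp hN n f_proper f_ge).
Qed.

Let phi_convex : convex_real phi .
Proof. exact: reg_envelope_convex. Qed.

Let phi_bounded : locally_bounded_above phi.
Proof. exact: reg_envelope_locally_bounded. Qed.

Let phi_continuous : continuous phi.
Proof. exact: reg_envelope_continuous. Qed.

Let KNp_convex : convex_real KNp.
Proof.
have := convex_realZ 0 (reg_weight_ge0 p n) (eqnorm_pow_convex hp hN).
by move=> H x y t t01; have := H x y t t01; rewrite !addr0.
Qed.

Let KNp_continuous : continuous KNp.
Proof.
by move=> x; apply: cvgM; [exact: cvg_cst|exact: eqnorm_pow_continuous].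
Qed.

Let KNp_bounded : locally_bounded_above KNp.
Proof. exact: continuous_locally_bounded. Qed.

Lemma convex_real_convex_function h : convex_real h -> convex_function setT h.
Proof.
move=> hc t x y _ _; rewrite !convRE; have := hc x y t%:num.
rewrite ge0 le1 => /(_ isT); exact.
Qed.

Lemma Delta_reg_Delta_convex : Delta_convex (Delta_reg N p n f).
Proof.
exists phi, KNp; split.
- by split => //; exact: convex_real_convex_function.
- by split => //; exact: convex_real_convex_function.
- by move=> x; rewrite Delta_regE.
Qed.

(** The weight [K * (1 + Np)] equals [(m + K * Np) + (K - m)], the form required for the transfer to
    the envelope. On a ball the envelope and [Np] are bounded, which turns the weighted estimate
    into a plain one. *)
Let second_diff_weighted (M : R) : 0 <= M -> exists2 L : R, 0 < L &
  forall (s : R) v, 0 <= s ->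
    (forall x, second_diff Np x v <= s * (1 + Np x)) ->
    forall x, N x <= M ->
      second_diff phi x v <= s * L /\ second_diff KNp x v <= s * L.
Proof.
move=> M0; have [B hB] := reg_envelope_bounded hp hN n f_proper f_ge M.
have K0 := reg_weight_ge0 p n.
exists (2 * (`|B| + K + `|m|) + K * (1 + M `^ p) + 1).
  by rewrite ltr_wpDl// !addr_ge0// !mulr_ge0// !addr_ge0// ?powR_ge0.
move=> s v s0 H x xM.
have h1 : second_diff phi x v <= 2 * (s * phi x + s * (K - m)).
  apply: (@second_diff_envelope _ p hp _ N hN n f f_proper m f_ge s) => // z.
  have := ler_wpM2l K0 (H z); lra.
have KM : 0 <= K * (1 + M `^ p) by rewrite mulr_ge0// addr_ge0// powR_ge0.
split.
  apply: (le_trans h1).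
  have -> : 2 * (s * phi x + s * (K - m)) = s * (2 * (phi x + K - m)) by ring.
  apply: ler_wpM2l => //.
  have := hB x xM; have := ler_norm B; have := ler_norm (- m).
  rewrite normrN; lra.
rewrite second_diffZ; have := ler_wpM2l K0 (H x).
move/le_trans; apply; rewrite mulrCA; apply: ler_wpM2l => //.
have : K * (1 + Np x) <= K * (1 + M `^ p).
  by rewrite ler_wpM2l// lerD2l; exact: eqnorm_pow_le.
have := normr_ge0 B; have := normr_ge0 m; lra.
Qed.

Let second_diff_unif (M e : R) : 0 < M -> 0 < e -> exists2 d : R, 0 < d &
  forall x v, `|x| <= M -> `|v| <= d ->
    second_diff phi x v <= e * `|v| /\ second_diff KNp x v <= e * `|v|.
Proof.
case: (hN) => _ _ [c [C [c0 C0 cC]]] M0 e0.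
have [L L0 hL] := second_diff_weighted (ltW (mulr_gt0 C0 M0)).
have CL0 : 0 < C * L by rewrite mulr_gt0.
have [d d0 hd] := second_diff_pow_unif hp hN hU (divr_gt0 e0 CL0).
exists (d / C) => [|x v xM vd]; first by rewrite divr_gt0.
have vN : N v <= d.
  by apply: (le_trans (cC v).2); rewrite mulrC -ler_pdivlMr.
have s0 : 0 <= e / (C * L) * N v.
  by rewrite mulr_ge0 ?(eqnorm_ge0 hN)// divr_ge0// ltW.
have xN : N x <= C * M by apply: (le_trans (cC x).2); rewrite ler_pM2l.
have [h1 h2] := hL _ v s0 (fun z => hd z v vN) x xN.
have h3 : e / (C * L) * N v * L <= e * `|v|.
  have -> : e / (C * L) * N v * L = e / C * N v.
    by field; rewrite !gt_eqF.
  rewrite -mulrA ler_pM2l// ler_pdivrMl//; exact: (cC v).2.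
by split; [exact: le_trans h1 h3|exact: le_trans h2 h3].
Qed.

Let second_diff_littleo x (e : R) : 0 < e -> exists2 d : R, 0 < d &
  forall v, `|v| <= d ->
    second_diff phi x v <= e * `|v| /\ second_diff KNp x v <= e * `|v|.
Proof.
move=> e0; have M0 : 0 < 1 + `|x| by rewrite ltr_pwDl.
have [d d0 hd] := second_diff_unif M0 e0.
by exists d => // v vd; apply: hd => //; rewrite lerDr.
Qed.

Lemma Delta_reg_C1u : C1u_bounded (Delta_reg N p n f).
Proof.
exists (fun x => phi x - K * Np x); first exact: Delta_regE.
by apply: (C1u_bounded_convex_diff phi_convex KNp_convex).
Qed.

Lemma Delta_reg_C1hoelder_bounded a : 0 < a <= 1 ->
  smoothness_power_type N (1 + a) ->
  C1hoelder_bounded (Num.min a (p - 1)) (Delta_reg N p n f).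
Proof.
have p1 := hp; move=> a01 ha; have /andP[a0 a1] := a01.
case: (hN) => _ _ [c [C [c0 C0 cC]]].
set b := Num.min a (p - 1).
have b0 : 0 < b by rewrite lt_min a0/= subr_gt0.
have [ba bp] : b <= a /\ b <= p - 1 by rewrite /b !ge_min !lexx orbT.
exists (fun x => phi x - K * Np x); first exact: Delta_regE.
split => [x|A Ab]; first exact: (differentiable_convex_diff phi_convex KNp_convex).
have [M M0 hM] := bounded_setW Ab.
have CM0 : 0 < C * M by rewrite mulr_gt0.
have [L L0 hL] := second_diff_weighted (ltW CM0).
have b_ge : 1 <= 1 + b by lra.
have b_lep : 1 + b <= p by lra.
have b_lea : 1 + b <= 1 + a by lra.
have [D D0 hD] := second_diff_pow_hoelder hp hN a01 ha b_ge b_lep b_lea.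
(* [T] bounds [N w] for increments between points of [A], so [N w]^ (p - (1 +
   b))[is absorbed in]E[, while]N z [^ (p - (1 + b))] is absorbed in the weight [1 + Np z]. *)
pose T := 4 * (C * M); pose E := D * (1 + T `^ (p - (1 + b))).
have T0 : 0 < T by rewrite mulr_gt0.
have E0 : 0 <= E by rewrite mulr_ge0 ?(ltW D0)// addr_ge0// powR_ge0.
apply: (@derivative_hoelder_convex_diff _ _ _ _ phi_convex KNp_convex
  phi_bounded KNp_bounded second_diff_littleo _ _ (E * C `^ (1 + b) * L)) => //.
  apply: mulr_ge0; last exact: ltW.
  by apply: mulr_ge0 => //; exact: powR_ge0.
move=> x y w Ax Ay wxy.
have wN := eqnorm_ge0 hN w.
have wT : N w <= T.
  apply: (le_trans (cC w).2); rewrite /T mulrCA ler_pM2l//.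
  apply: (le_trans wxy); have := hM x Ax; have := hM y Ay.
  have := ler_normB x y; lra.
have wE : 0 <= E * N w `^ (1 + b) by rewrite mulr_ge0// powR_ge0.
have xN : N x <= C * M.
  by apply: (le_trans (cC x).2); rewrite ler_pM2l//; exact: hM.
have [z|h1 h2] := hL _ w wE _ x xN.
  apply: (le_trans (hD z w)).
  have q1 : N z `^ (p - (1 + b)) <= 1 + Np z.
    apply: powR_le_1D => //; last exact: eqnorm_ge0.
    by apply/andP; split; lra.
  have q2 : N w `^ (p - (1 + b)) <= T `^ (p - (1 + b)).
    by apply: ge0_ler_powR; rewrite ?nnegrE ?(ltW T0)//; lra.
  have q3 : N z `^ (p - (1 + b)) + N w `^ (p - (1 + b)) <=
      (1 + T `^ (p - (1 + b))) * (1 + Np z).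
    have := mulr_ge0 (powR_ge0 T (p - (1 + b))) (eqnorm_pow_ge0 p N z); lra.
  have -> : E * N w `^ (1 + b) * (1 + Np z) =
      D * N w `^ (1 + b) * ((1 + T `^ (p - (1 + b))) * (1 + Np z)).
    by rewrite /E; ring.
  by apply: ler_wpM2l => //; rewrite mulr_ge0 ?powR_ge0// ltW.
have h3 : E * N w `^ (1 + b) * L <= E * C `^ (1 + b) * L * `|w| `^ (1 + b).
  have -> : E * C `^ (1 + b) * L * `|w| `^ (1 + b) =
      E * (C * `|w|) `^ (1 + b) * L by rewrite powRM ?(ltW C0)//; ring.
  apply: ler_wpM2r; first exact: ltW.
  apply: ler_wpM2l => //; apply: ge0_ler_powR; rewrite ?nnegrE//; first lra.
    by rewrite mulr_ge0// ltW.
  exact: (cC w).2.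
by split; [exact: le_trans h1 h3|exact: le_trans h2 h3].
Qed.

Lemma Delta_reg_C1hoelder a : 0 < a <= 1 ->
  smoothness_power_type N (1 + a) -> p = 1 + a ->
  C1hoelder a (Delta_reg N p n f).
Proof.
have p1 := hp; move=> a01 ha pE; have /andP[a0 a1] := a01.
case: (hN) => _ _ [c [C [c0 C0 cC]]].
exists (fun x => phi x - K * Np x); first exact: Delta_regE.
split => [x|]; first exact: (differentiable_convex_diff phi_convex KNp_convex).
have p_lea : p <= 1 + a by rewrite pE.
have [D D0 hD] := second_diff_pow_hoelder hp hN a01 ha (ltW p1) (lexx p) p_lea.
have K0 := reg_weight_ge0 p n.
apply: (@derivative_hoelder_convex_diff _ _ _ _ phi_convex KNp_convex
  phi_bounded KNp_bounded second_diff_littleo _ _ (4 * K * D * C `^ p)) => //.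
  apply: mulr_ge0; last exact: powR_ge0.
  by apply: mulr_ge0; [exact: mulr_ge0|exact: ltW].
move=> x y w _ _ _; rewrite -pE.
(* For [q = p] both weights are zeroth powers, equal to 1 even at 0. The estimate is thus uniform in
   [z], and the transfer applies with [s = 0] on the whole space. *)
have hDw z : second_diff Np z w <= 2 * D * N w `^ p.
  by have := hD z w; rewrite subrr !powRr0; lra.
have Nw : N w `^ p <= C `^ p * `|w| `^ p.
  rewrite -powRM ?(ltW C0)//; apply: ge0_ler_powR; rewrite ?nnegrE//; first lra.
  - exact: eqnorm_ge0.
  - by rewrite mulr_ge0// ltW.
  - exact: (cC w).2.
have KD : 0 <= K * D by rewrite mulr_ge0// ltW.
have h3 := ler_wpM2l KD Nw.
have h4 z := ler_wpM2l K0 (hDw z).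
have h5 : 0 <= K * D * N w `^ p by rewrite mulr_ge0// powR_ge0.
split; last by rewrite second_diffZ; have := h4 x; lra.
have : second_diff phi x w <= 2 * (0 * phi x + K * (2 * D * N w `^ p)).
  apply: (@second_diff_envelope _ p hp _ N hN n f f_proper m f_ge) => // z.
  by rewrite mul0r add0r; exact: h4.
by lra.
Qed.

End regularity.

(** * Convergence *)

Section chain.
Context {R : realType} {X : normedModType R}.
Implicit Types (h : X -> R) (x y : X).

(** The segment is cut into [k] equal pieces; with [k] the truncation of [D / d] plus one, each
    piece is strictly shorter than [d] and [k <= 1 + D / d]. *)
Lemma chain_le h x y (d e : R) : 0 < d -> 0 <= e ->
  (forall s t : R, 0 <= s <= 1 -> 0 <= t <= 1 -> `|s - t| * `|y - x| < d ->
    `|h (x + s *: (y - x)) - h (x + t *: (y - x))| <= e) ->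
  `|h x - h y| <= e * (1 + `|y - x| / d).
Proof.
move=> d0 e0 H; set D := `|y - x|; pose k := (Num.truncn (D / d)).+1.
have Dd : 0 <= D / d by rewrite divr_ge0 ?normr_ge0 ?(ltW d0).
have k0 : 0 < k%:R :> R by rewrite ltr0n.
have kgt : D / d < k%:R by rewrite /k; apply: truncnS_gt.
have kle : k%:R <= 1 + D / d.
  by rewrite /k -natr1 addrC lerD2l truncn_le.
have step (i : nat) : (i <= k)%N ->
    `|h x - h (x + (i%:R / k%:R) *: (y - x))| <= i%:R * e.
  elim: i => [|i IH] ik; first by rewrite !mul0r scale0r addr0 subrr normr0.
  have h1 := IH (ltnW ik).
  have -> : i.+1%:R * e = i%:R * e + e by rewrite -natr1 mulrDl mul1r.
  apply: le_trans (ler_distD (h (x + (i%:R / k%:R) *: (y - x))) _ _) _.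
  apply: lerD => //; apply: H.
  - by rewrite divr_ge0//= ler_pdivrMr// mul1r ler_nat ltnW.
  - by rewrite divr_ge0//= ler_pdivrMr// mul1r ler_nat.
  - rewrite -/D -natr1 mulrDl opprD addrA subrr add0r mul1r normrN.
    by rewrite gtr0_norm ?invr_gt0// mulrC ltr_pdivrMr// mulrC -ltr_pdivrMr.
have := step k (leqnn k); rewrite divff ?gt_eqF// scale1r [x + _]addrC subrK.
by move/le_trans; apply; rewrite mulrC ler_wpM2l.
Qed.

Lemma unif_continuous_bounded h (A : set X) : unif_continuous_on_bounded h ->
  bounded_set A -> exists B : R, forall x, A x -> h x <= B.
Proof.
move=> hu Ab; have [M M0 hM] := bounded_setW Ab.
have bM : bounded_set [set x : X | `|x| <= M].
  exists M; split => [|M' MM' x /= xM]; first by rewrite num_real.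
  exact: le_trans (ltW MM').
have [d d0 hd] := hu _ bM 1 ltr01.
exists (h 0 + (1 + M / d)) => x Ax.
have ball (s : R) : 0 <= s <= 1 -> `|0 + s *: (x - 0)| <= M.
  move=> /andP[s0 s1]; rewrite add0r subr0 normrZ ger0_norm//.
  by have := hM x Ax; have := normr_ge0 x; nra.
have := @chain_le h 0 x d 1 d0 ler01.
have -> : 1 * (1 + `|x - 0| / d) = 1 + `|x| / d by rewrite mul1r subr0.
have h1 : `|x| / d <= M / d by rewrite ler_pM2r ?invr_gt0//; exact: hM.
move=> H; suff : `|h 0 - h x| <= 1 + `|x| / d by rewrite ler_norml; lra.
apply: H => s t s01 t01 st; apply/ltW/hd; [exact: ball|exact: ball|].
by rewrite opprD addrACA subrr add0r -scalerBl normrZ.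
Qed.

Lemma unif_continuous_growth h (e : R) : unif_continuous h -> 0 < e ->
  exists2 L : R, 0 < L & forall x y, `|h x - h y| <= e + L * `|x - y|.
Proof.
move=> /unif_continuousP hu e0; have [d d0 hd] := hu e e0.
exists (e / d) => [|x y]; first by rewrite divr_gt0.
have -> : e + e / d * `|x - y| = e * (1 + `|y - x| / d) by rewrite distrC; ring.
apply: chain_le => // [|s t _ _ st]; first exact: ltW.
have := hd (x + s *: (y - x), x + t *: (y - x)); rewrite -!ball_normE /= => H.
by apply/ltW/H; rewrite opprD addrACA subrr add0r -scalerBl normrZ.
Qed.

End chain.

(** * Lower bounds on the regularization and the resulting modes of convergence *)

Section convergence.
Context {R : realType}.
Variable p : R.
Hypothesis hp : (1 : R) < p.
Context {X : normedModType R}.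
Variable N : X -> R.
Hypothesis hN : equivalent_norm N.
Hypothesis hU : uniformly_smooth N.
Implicit Types (f : X -> \bar R) (h : X -> R) (x y z : X) (m M D r : R).

Local Notation gap := (conv_gap p N).

(** For [y] near [x] the bound [M] on [f] is used and the cost is dropped; for [y] far away the cost
    adds [n * D] to the global lower bound. *)
Lemma Delta_reg_ge_min n f m M D r x : (forall y, (m%:E <= f y)%E) ->
  (forall y, N (x - y) < r -> (M%:E <= f y)%E) ->
  (forall z y, r <= N (x - y) -> D <= gap x z + gap z y) ->
  ((Num.min M (m + n%:R * D))%:E <= Delta_reg N p n f x)%E.
Proof.
move=> fm fM hD; apply: Delta_reg_ge => // z y.
have [ry|yr] := leP r (N (x - y)).
  apply: (@le_trans _ _ (m + n%:R * D)%:E).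
    by rewrite lee_fin ge_min lexx orbT.
  by rewrite EFinD leeD// lee_fin ler_wpM2l//; exact: hD.
apply: (@le_trans _ _ M%:E); first by rewrite lee_fin ge_min lexx.
rewrite -[leLHS]adde0 leeD ?fM// lee_fin mulr_ge0// addr_ge0//;
  exact: conv_gap_ge0.
Qed.

Lemma Delta_reg_ge_lb n f m x : (forall y, (m%:E <= f y)%E) ->
  (m%:E <= Delta_reg N p n f x)%E.
Proof.
move=> fm; apply: Delta_reg_ge => // z y.
rewrite -[leLHS]adde0 leeD// lee_fin mulr_ge0// addr_ge0//;
  exact: conv_gap_ge0.
Qed.

Lemma Delta_reg_ge_local f m M x0 : locally_uniformly_convex N ->
  lower_semicontinuous f -> (forall y, (m%:E <= f y)%E) -> (M%:E < f x0)%E ->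
  exists2 D, 0 < D & \forall x \near x0, forall n,
    ((Num.min M (m + n%:R * D))%:E <= Delta_reg N p n f x)%E.
Proof.
case: (hN) => _ _ [c [C [c0 C0 cC]]] hL flsc fm fx0.
have [V /nbhs_normP[d /= d0 dV] VM] := flsc x0 M fx0.
(* Half of [c * d], so that [y] within [r] of [x] and [x] within [r] of [x0] force [y] into the
   neighborhood given by semicontinuity. *)
pose r := c * d / 2; have r0 : 0 < r by rewrite divr_gt0// mulr_gt0.
have [s [D [s0 D0 hD]]] := local_gap2 hp hN hL x0 r0.
pose t := Num.min s r; have t0 : 0 < t by rewrite lt_min s0.
have [ts tr] : t <= s /\ t <= r by rewrite /t !ge_min !lexx orbT.
exists D => //; apply/nbhs_normP; exists (t / C) => /= [|x /= xt n].
  by rewrite divr_gt0.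
have Nx : N (x0 - x) < t.
  by apply: (le_lt_trans (cC _).2); rewrite mulrC -ltr_pdivlMr.
apply: (@Delta_reg_ge_min _ _ _ _ _ r) => // [y xy|z y xy]; last first.
  by apply: hD => //; lra.
apply/ltW/VM/dV => /=; rewrite -(ltr_pM2l c0).
apply: (le_lt_trans (cC _).1).
have := eqnormD hN (x0 - x) (x - y); rewrite addrA subrK => h.
have : c * d = r + r by rewrite /r -splitr.
lra.
Qed.

Lemma Delta_reg_ge_unif f m M r : uniformly_convex N ->
  (forall y, (m%:E <= f y)%E) -> 0 < M -> 0 < r -> exists2 D, 0 < D &
  forall n x (a : R), N x <= M -> (forall y, N (x - y) < r -> (a%:E <= f y)%E) ->
    ((Num.min a (m + n%:R * D))%:E <= Delta_reg N p n f x)%E.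
Proof.
move=> hC fm M0 r0; have [D D0 hD] := uniform_gap2 hp hN hC M0 r0.
exists D => // n x a xM fa; apply: (@Delta_reg_ge_min _ _ _ _ _ r) => // z y.
exact: hD.
Qed.

Lemma cvg_from_below (l : \bar R) (u : nat -> \bar R) : (-oo < l)%E ->
  (forall n, (u n <= l)%E) ->
  (forall M, (M%:E < l)%E -> \forall n \near \oo, (M%:E <= u n)%E) ->
  u n @[n --> \oo] --> l.
Proof.
case: l => [r||] // _ ur uM; last first.
  by apply/cvgeyPge => A; apply: uM; rewrite ltry.
apply/fine_cvgP.
have ufin (e : R) : 0 < e -> \forall n \near \oo,
    u n \is a fin_num /\ r - e <= fine (u n) <= r.
  move=> e0; have : ((r - e)%:E < r%:E)%E by rewrite lte_fin ltrBlDr ltrDl.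
  move/uM; apply: filterS => n; have := ur n.
  by case: (u n) => //= a; rewrite !lee_fin => -> ->.
split.
  by apply: (filterS _ (ufin 1 ltr01)) => n [].
apply/cvgrPdist_le => e e0; apply: (filterS _ (ufin e e0)) => n [_ /andP[h1 h2]].
by rewrite /= ler_norml; lra.
Qed.

Lemma Delta_reg_cvg f m x : locally_uniformly_convex N ->
  lower_semicontinuous f -> (-oo < f x)%E -> (forall y, (m%:E <= f y)%E) ->
  Delta_reg N p n f x @[n --> \oo] --> f x.
Proof.
move=> hL flsc fx fm; apply: (cvg_from_below fx) => [n|M Mfx].
  exact: Delta_reg_le.
have [D D0 /nbhs_singleton hD] := Delta_reg_ge_local hL flsc fm Mfx.
near=> n; apply: le_trans (hD n); rewrite lee_fin le_min lexx /=.
rewrite -lerBlDl -ler_pdivrMr//; near: n; exact: nbhs_infty_ger.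
Unshelve. all: by end_near. Qed.

Lemma Delta_reg_dist_le n h x (e : R) : 0 <= e ->
  ((h x - e)%:E <= Delta_reg N p n (EFin \o h) x)%E ->
  (`|Delta_reg N p n (EFin \o h) x - (h x)%:E| <= e%:E)%E.
Proof.
move=> e0; have := Delta_reg_le hp hN n (EFin \o h) x => /=.
case: (Delta_reg _ _ _ _ _) => //= a.
by rewrite !lee_fin => h1 h2; rewrite ler_norml; lra.
Qed.

(** The constant [D] of the local lower bound is common to all [x] near [x0] and all [n]; the
    near-covering form of compactness glues these local estimates together. *)
Lemma Delta_reg_cvg_compact h m (A : set X) : locally_uniformly_convex N ->
  continuous h -> (forall y, m <= h y) -> compact A ->
  cvg_uniformly_on A (fun n => Delta_reg N p n (EFin \o h)) h.
Proof.
move=> hL hcont hm /compact_near_coveringP cA e e0.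
have fm y : (m%:E <= (EFin \o h) y)%E by rewrite lee_fin.
have hlsc : lower_semicontinuous (EFin \o h).
  move=> y a; rewrite /= lte_fin => ay; exists [set z | a < h z] => [|z].
    exact: (hcont y _ (lt_nbhsr ay)).
  by rewrite /= lte_fin.
apply: (cA _ _ (fun n x => (`|Delta_reg N p n (EFin \o h) x - (h x)%:E| <= e%:E)%E)).
move=> x0 _; have e2 : 0 < e / 2 by rewrite divr_gt0.
have hx0 : ((h x0 - e / 2)%:E < (EFin \o h) x0)%E.
  by rewrite lte_fin ltrBlDr ltrDl.
have [D D0 hD] := Delta_reg_ge_local hL hlsc fm hx0.
have hx : \forall x \near x0, `|h x0 - h x| < e / 2.
  by have /cvgrPdist_lt := hcont x0; apply.
exists ([set x | `|h x0 - h x| < e / 2 /\ forall n,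
    ((Num.min (h x0 - e / 2) (m + n%:R * D))%:E
      <= Delta_reg N p n (EFin \o h) x)%E],
  [set n : nat | (h x0 - m) / D <= n%:R]) => /=.
  by split; [exact: filterI|exact: nbhs_infty_ger].
move=> [x n] /= [[h1 h2]]; rewrite ler_pdivrMr// => h3.
apply: Delta_reg_dist_le; first exact: ltW.
apply: le_trans (h2 n); rewrite lee_fin le_min.
by move: h1; rewrite ltr_norml => /andP[? ?]; apply/andP; split; lra.
Qed.

Lemma Delta_reg_cvg_bounded h m (A : set X) : uniformly_convex N ->
  unif_continuous_on_bounded h -> (forall y, m <= h y) -> bounded_set A ->
  cvg_uniformly_on A (fun n => Delta_reg N p n (EFin \o h)) h.
Proof.
case: (hN) => _ _ [c [C [c0 C0 cC]]] hC hu hm Ab e e0.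
have [M M0 hM] := bounded_setW Ab.
(* An upper bound of [h] on [A] yields one index from which [m + n * D] exceeds [h] on all of
   [A]. *)
have [B hB] := unif_continuous_bounded hu Ab.
have fm y : (m%:E <= (EFin \o h) y)%E by rewrite lee_fin.
have bM : bounded_set [set x : X | `|x| <= M + 1].
  exists (M + 1); split => [|M' MM' x /= xM]; first by rewrite num_real.
  exact: le_trans (ltW MM').
have [d d0 hd] := hu _ bM e e0.
pose t := Num.min d 1; have t0 : 0 < t by rewrite lt_min d0 ltr01.
have [td t1] : t <= d /\ t <= 1 by rewrite /t !ge_min !lexx orbT.
have [D D0 hD] := Delta_reg_ge_unif hC fm (mulr_gt0 C0 M0) (mulr_gt0 c0 t0).
exists (Num.truncn ((B - m) / D)).+1 => // n /= nD x Ax.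
have xM := hM x Ax.
apply: Delta_reg_dist_le; first exact: ltW.
have Bn : B - m <= n%:R * D.
  rewrite -ler_pdivrMr//; apply: le_trans (ltW (truncnS_gt _)) _.
  by rewrite ler_nat.
have xN : N x <= C * M by apply: (le_trans (cC x).2); rewrite ler_pM2l.
have hxy y : N (x - y) < c * t -> ((h x - e)%:E <= (EFin \o h) y)%E.
  move=> xy; have {xy} xy : `|x - y| < t.
    by rewrite -(ltr_pM2l c0); exact: le_lt_trans (cC _).1 xy.
  have yM : `|y| <= M + 1.
    by have := ler_normB x (x - y); rewrite subKr; lra.
  have := hd x y => /=; rewrite lee_fin => /(_ ltac:(lra) yM ltac:(lra)).
  by rewrite ltr_norml; lra.
apply: le_trans (hD n x _ xN hxy); rewrite lee_fin le_min lexx /=.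
by have := hB x Ax; lra.
Qed.

(** Uniform continuity bounds [h x - h y] by [e / 2 + L * t] with [t = |x - y|], which replaces a
    lower bound on [h]. The cost, at least [n * E * t]^ p[, compensates]L * t[when this exceeds]e /
    2[, for then]t [^ (p - 1)] is at least [q]. *)
Lemma Delta_reg_cvg_unif h : 2 <= p -> convexity_power_type N p ->
  unif_continuous h ->
  cvg_uniformly_on setT (fun n => Delta_reg N p n (EFin \o h)) h.
Proof.
have p1 := hp; case: (hN) => _ _ [c [C [c0 C0 cC]]] p2 hC hu e e0.
have e2 : 0 < e / 2 by rewrite divr_gt0.
have [L L0 hL] := unif_continuous_growth hu e2.
have [D D0 hD] := power_gap2 hp hN hC p2.
pose E := D * c `^ p; have E0 : 0 < E by rewrite mulr_gt0// powR_gt0.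
pose q := (e / 2 / L) `^ (p - 1); have q0 : 0 < q by rewrite powR_gt0// !divr_gt0.
exists (Num.truncn (L / (E * q))).+1 => // n /= nD x _.
apply: Delta_reg_dist_le; first exact: ltW.
have Ln : L <= n%:R * (E * q).
  have Eq0 : 0 < E * q by rewrite mulr_gt0.
  rewrite -(ler_pdivrMr _ _ Eq0); apply: le_trans (ltW (truncnS_gt _)) _.
  by rewrite ler_nat.
apply: Delta_reg_ge => // z y; rewrite /= -EFinD lee_fin.
have := hL x y; rewrite ler_norml => /andP[_ h1].
set t := `|x - y| in h1; have t0 : 0 <= t by rewrite /t.
have h2 : E * t `^ p <= gap x z + gap z y.
  apply: le_trans (hD x z y); rewrite /E -mulrA ler_pM2l// -powRM ?(ltW c0)//.
  apply: ge0_ler_powR; rewrite ?nnegrE ?(eqnorm_ge0 hN)//; first lra.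
    by rewrite mulr_ge0// ltW.
  exact: (cC _).1.
have h3 := ler_wpM2l (ler0n R n) h2.
suff : L * t <= e / 2 + n%:R * (E * t `^ p) by lra.
have [tle|tgt] := leP (L * t) (e / 2).
  have : 0 <= n%:R * (E * t `^ p).
    by rewrite mulr_ge0// mulr_ge0 ?powR_ge0// ltW.
  by lra.
have qt : q <= t `^ (p - 1).
  have eLt : e / 2 / L <= t by rewrite ler_pdivrMr//; lra.
  have eL0 : 0 <= e / 2 / L by rewrite divr_ge0 ?(ltW L0) ?(ltW e2).
  by apply: ge0_ler_powR; rewrite ?nnegrE//; lra.
rewrite -(@mulr_powRB1 _ t p)//; last lra.
have h4 : n%:R * (E * q) * t <= n%:R * (E * t `^ (p - 1)) * t.
  by apply: ler_wpM2r => //; apply: ler_wpM2l => //; rewrite ler_pM2l.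
have h5 := ler_wpM2r t0 Ln.
by lra.
Qed.

Lemma inf_fun_fin f : proper_fun f -> bounded_below f ->
  exists2 m, inf_fun f = m%:E & forall x, (m%:E <= f x)%E.
Proof.
move=> [_ [x0 fx0]] [m fm].
have h1 : (m%:E <= inf_fun f)%E by apply: le_ereal_inf_tmp => _ [x _ <-].
have h2 x : (inf_fun f <= f x)%E by apply: ereal_inf_lbound; exists x.
have := le_lt_trans (h2 x0) fx0; move: h1 h2.
by case: (inf_fun f) => // r _ h2 _; exists r.
Qed.

Lemma minimizers_Delta_reg n f : (0 < n)%N -> locally_uniformly_convex N ->
  proper_fun f -> lower_semicontinuous f -> bounded_below f ->
  minimizers (Delta_reg N p n f) = minimizers f.
Proof.
move=> n0 hL fp flsc fb; have [m fE fm] := inf_fun_fin fp fb.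
have le_f x := Delta_reg_le hp hN n f x.
have ge_m x : (m%:E <= Delta_reg N p n f x)%E by exact: Delta_reg_ge_lb.
have DE : inf_fun (Delta_reg N p n f) = m%:E.
  apply/eqP; rewrite eq_le; apply/andP; split.
    rewrite -fE; apply: le_ereal_inf_tmp => _ [x _ <-].
    by apply: le_trans (le_f x); apply: ereal_inf_lbound; exists x.
  by apply: le_ereal_inf_tmp => _ [x _ <-].
rewrite /minimizers DE fE; apply/seteqP; split => x /= xE; last first.
  by apply/eqP; rewrite eq_le ge_m -{1}xE le_f.
apply/eqP; rewrite eq_le fm andbT leNgt; apply/negP => mf.
(* If [f x] exceeded the infimum [m], an intermediate [M] would give [min M (m + n * D) > m] as a
   lower bound at [x], because [n] is positive, whereas the value there is [m]. *)
have [M mM Mf] : exists2 M, m < M & (M%:E < f x)%E.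
  move: mf; case: (f x) => [r||] //; last by exists (m + 1); rewrite ?ltrDl ?ltry.
  by rewrite lte_fin => mr; exists ((m + r) / 2); rewrite ?lte_fin; lra.
have [D D0 /nbhs_singleton/(_ n)] := Delta_reg_ge_local hL flsc fm Mf.
rewrite xE lee_fin ge_min; apply/negP; rewrite negb_or -!ltNge mM /=.
by rewrite ltrDl mulr_gt0// ltr0n.
Qed.

End convergence.

(* In the second clause of (ii) the exponent is min(a, p - 1), which is a as
   soon as 1 + a <= p: the smoothness at the origin of N `^ p is limited by p
   (for f = 0 at 0 and +oo elsewhere, Delta_reg N p n f is
   (2 `^ (p - 1) - 1) * n * N `^ p). *)
Theorem theorem1 (R : realType) (X : completeNormedModType R) (N : X -> R)
    (p : R) (hp : 1 < p) (hN : equivalent_norm N)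
    (hLUC : locally_uniformly_convex N) (hUS : uniformly_smooth N) :
  (forall f : X -> \bar R,
    proper_fun f -> lower_semicontinuous f -> bounded_below f ->
    [/\ forall n, (0 < n)%N -> Delta_convex (Delta_reg N p n f),
      (* (i) *)
      forall n, (0 < n)%N ->
        (forall x, (inf_fun f <= Delta_reg N p n f x)%E /\
                   (Delta_reg N p n f x <= f x)%E) /\
        minimizers (Delta_reg N p n f) = minimizers f,
      (* (ii) *)
      (forall n, (0 < n)%N -> C1u_bounded (Delta_reg N p n f)) /\
      (forall a : R, 0 < a <= 1 -> smoothness_power_type N (1 + a) ->
        forall n, (0 < n)%N ->
          C1hoelder_bounded (Num.min a (p - 1)) (Delta_reg N p n f) /\
          C1hoelder a (Delta_reg N (1 + a) n f)),
      (* (iii) *)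
      (forall x, Delta_reg N p n f x @[n --> \oo] --> f x) /\
      (forall h : X -> R, f = EFin \o h -> continuous h ->
        forall K : set X, compact K ->
          cvg_uniformly_on K (fun n => Delta_reg N p n f) h) &
      (* (iv) *)
      uniformly_convex N ->
      forall h : X -> R, f = EFin \o h -> unif_continuous_on_bounded h ->
        forall A : set X, bounded_set A ->
          cvg_uniformly_on A (fun n => Delta_reg N p n f) h]) /\
  (* (v) *)
  (uniformly_convex N -> 2 <= p -> convexity_power_type N p ->
    forall h : X -> R, unif_continuous h ->
      cvg_uniformly_on setT (fun n => Delta_reg N p n (EFin \o h)) h).
Proof.
split=> [f fp flsc fb|hC p2 hCp h hu]; last exact: Delta_reg_cvg_unif.
have [m fE fm] := inf_fun_fin fp fb.
split.
- by move=> n _; exact: (Delta_reg_Delta_convex hp hN _ fp fm).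
- move=> n n0; split; last exact: minimizers_Delta_reg.
  by move=> x; split; [rewrite fE; exact: Delta_reg_ge_lb|exact: Delta_reg_le].
- split=> [n _|a a01 ha n _]; first exact: (Delta_reg_C1u hp hN hUS _ fp fm).
  split; first exact: (Delta_reg_C1hoelder_bounded hp hN hUS _ fp fm a01 ha).
  have a1 : 1 < 1 + a by case/andP: a01 => a0 _; rewrite ltrDl.
  exact: (Delta_reg_C1hoelder a1 hN hUS _ fp fm a01 ha erefl).
- split=> [x|h hf hcont A cA].
    exact: (Delta_reg_cvg hp hN hUS hLUC flsc (fp.1 x) fm).
  rewrite hf in fm *; have hm y : m <= h y by have := fm y; rewrite lee_fin.
  exact: (Delta_reg_cvg_compact hp hN hUS hLUC hcont hm cA).
- move=> hC h hf hu A Ab.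
  rewrite hf in fm *; have hm y : m <= h y by have := fm y; rewrite lee_fin.
  exact: (Delta_reg_cvg_bounded hp hN hUS hC hu hm Ab).
Qed.
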